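(* Let $m\ge1$, $I\subset\{0,\dots,m\}$ nonempty, and $\mu\in X_*$ any cocharacter of $GSp_{2m}$. Then $\mathrm{Adm}_{GSp_{2m},I}(\mu)=\mathrm{Adm}_{GL_{2m},\pm I}(\mu)\cap\widetilde W/W_I$, where $\widetilde W/W_I$ is regarded as a subset of $\widetilde W_{GL_{2m}}/W_{GL_{2m},\pm I}$.
   Context: Notation: $(x^{(p)},y^{(q)})$ is $x$ repeated $p$ times then $y$ repeated $q$ times; $\mathbf b=(b,\dots,b)$. GL side: $\widetilde W_{GL_{2m}}=\mathbb Z^{2m}\rtimes S_{2m}$ acting on $\mathbb R^{2m}$ by affine transformations ($t_\lambda\sigma:x\mapsto\lambda+\sigma x$, $S_{2m}$ permuting coordinates); affine root hyperplanes are the zero loci of $x_i-x_j-k$ ($i<j$, $k\in\mathbb Z$); the affine Weyl group is generated by reflections across them; base alcove $A_{GL}=\{x\in\mathbb R^{2m}:x_1<x_2<\dots<x_{2m}<x_1+1\}$, whose vertices are the points $\omega_i$ below; Bruhat order on $\widetilde W_{GL_{2m}}$: Coxeter Bruhat order on the affine Weyl group (simple reflections = reflections across walls of $A_{GL}$), extended by $x\omega\le x'\omega'$ iff $\omega=\omega'$ and $x\le x'$, where $\omega,\omega'$ lie in the stabilizer of $A_{GL}$. For $i=2mb+c$, $0\le c<2m$, $\omega_i=((-1)^{(c)},0^{(2m-c)})-\mathbf b$. $W_{GL_{2m},\pm I}$ is the stabilizer in $\widetilde W_{GL_{2m}}$ of all $\omega_i$ with $i\in2m\mathbb Z\pm I$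 (integers congruent mod $2m$ to an element of $I\cup(-I)$). Bruhat order on cosets: compare minimal-length representatives. $\mathrm{Adm}_{GL_{2m},\pm I}(\mu)$ is the set of $w\in\widetilde W_{GL_{2m}}/W_{GL_{2m},\pm I}$ with $w\le t_{\sigma\mu}W_{GL_{2m},\pm I}$ for some $\sigma\in S_{2m}$. GSp side: $X_*=\{x\in\mathbb Z^{2m}:x_1+x_{2m}=\dots=x_m+x_{m+1}\}$, $V=X_*\otimes\mathbb R$, $S_{2m}^*=\{\sigma\in S_{2m}:\sigma(2m+1-j)=2m+1-\sigma(j)\ \forall j\}$, $\widetilde W=X_*\rtimes S_{2m}^*\subset\widetilde W_{GL_{2m}}$; affine Weyl group $W_a$ generated by affine reflections of $V$ in $\widetilde W$ across the zero loci in $V$ of $x_i-x_j-k$; base alcove $A=\{x\in V:x_{2m}-1<x_1<\dots<x_m<x_{m+1}\}$ with stabilizer $\Omega$, $\widetilde W=W_a\rtimes\Omega$, Bruhat order defined analogously. $W_I$ is the stabilizer in $\widetilde W$ of all $\omega_i$, $i\in2m\mathbb Z\pm I$; then $W_I=\widetilde W\cap W_{GL_{2m},\pm I}$, so $\widetilde W/W_I$ injects into $\widetilde W_{GL_{2m}}/W_{GL_{2m},\pm I}$. $\mathrm{Adm}_{GSp_{2m},I}(\mu)$ is the set of $w\in\widetilde W/W_I$ with $w\le t_{\sigma\mu}W_I$ for some $\sigma\in S_{2m}^*$ (Bruhat order on $\widetilde W/W_I$ via minimal-length representatives). *)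

(* Defs.v *)
From HB Require Import structures.
From mathcomp Require Import all_boot all_order all_algebra all_fingroup.
From mathcomp Require Import Rstruct.
Set Implicit Arguments. Unset Strict Implicit. Unset Printing Implicit Defensive.
Import Order.TTheory GRing.Theory Num.Theory.
Local Open Scope ring_scope.

(* Throughout n = 2m and coordinates are indexed 0..2m-1 (paper: 1..2m);
   the paper's index 2m+1-j is rev_ord j (value n-1-j). *)

Section Aff.
Variable n : nat.

(* An element t_lambda sigma of Z^n x| S_n, acting by x |-> lambda + sigma x,
   where (sigma x)_i = x_{sigma^-1 i}. *)
Record aff := Aff { tr : {ffun 'I_n -> int}; pm : {perm 'I_n} }.

Definition pact (s : {perm 'I_n}) (l : {ffun 'I_n -> int}) : {ffun 'I_n -> int} :=
  [ffun a => l (s^-1 a)%g].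

(* product w v = (w o v) as affine maps *)
Definition amul (w v : aff) : aff :=
  Aff [ffun a => tr w a + tr v ((pm w)^-1 a)%g] (pm v * pm w)%g.

Definition ainv (w : aff) : aff :=
  Aff [ffun a => - tr w (pm w a)] (pm w)^-1%g.

Definition transl (l : {ffun 'I_n -> int}) : aff := Aff l 1%g.

Definition act_int (w : aff) (x : {ffun 'I_n -> int}) : {ffun 'I_n -> int} :=
  [ffun a => tr w a + x ((pm w)^-1 a)%g].

Definition act_R (w : aff) (x : 'I_n -> Rdefinitions.R) : 'I_n -> Rdefinitions.R :=
  fun a => (tr w a)%:~R + x ((pm w)^-1 a)%g.

(* the affine reflection across the zero locus of x_i - x_j - k (i <> j) *)
Definition refl (i j : 'I_n) (k : int) : aff :=
  Aff [ffun a => if a == i then k else if a == j then - k else 0] (tperm i j).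

(* ---------- Coxeter-theoretic notions, relative to a group G (a predicate),
   a set S of simple reflections and the stabilizer Om of the base alcove. *)

Inductive wordlen (S Om : aff -> Prop) : aff -> nat -> Prop :=
| wl0 w : Om w -> wordlen S Om w 0
| wlS s w k : S s -> wordlen S Om w k -> wordlen S Om (amul s w) k.+1.

Definition length_is (S Om : aff -> Prop) (w : aff) (k : nat) : Prop :=
  wordlen S Om w k /\ forall k', wordlen S Om w k' -> (k <= k')%N.

Definition len_lt S Om (u v : aff) : Prop :=
  exists k k', [/\ length_is S Om u k, length_is S Om v k' & (k < k')%N].
Definition len_le S Om (u v : aff) : Prop :=
  exists k k', [/\ length_is S Om u k, length_is S Om v k' & (k <= k')%N].

Definition isrefl (G S : aff -> Prop) (t : aff) : Prop :=
  exists w s, [/\ G w, S s & t = amul (amul w s) (ainv w)].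

Inductive bruhat (G S Om : aff -> Prop) : aff -> aff -> Prop :=
| br_refl w : G w -> bruhat G S Om w w
| br_step u v t : bruhat G S Om u v -> isrefl G S t ->
    len_lt S Om v (amul t v) -> bruhat G S Om u (amul t v).

Definition in_coset (P : aff -> Prop) (w v : aff) : Prop := P (amul (ainv w) v).

Definition minrep (G S Om P : aff -> Prop) (w v : aff) : Prop :=
  [/\ G v, in_coset P w v & forall u, G u -> in_coset P w u -> len_le S Om v u].

Definition coset_le (G S Om P : aff -> Prop) (w w' : aff) : Prop :=
  exists v v', [/\ minrep G S Om P w v, minrep G S Om P w' v' & bruhat G S Om v v'].

End Aff.

Section GL_GSp.
Variable m : nat.
Local Notation n := (m.*2).
Local Notation aff := (aff n).

Definition rv (j : 'I_n) : 'I_n := rev_ord j.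

Definition GLgrp (w : aff) : Prop := True.

Definition alcove_GL (x : 'I_n -> Rdefinitions.R) : Prop :=
  (forall a b : 'I_n, b = a.+1 :> nat -> x a < x b) /\
  (forall a b : 'I_n, a = 0%N :> nat -> b = n.-1 :> nat -> x b < x a + 1).

Definition Omega_GL (w : aff) : Prop :=
  forall x, alcove_GL x <-> alcove_GL (act_R w x).

(* reflections across the walls of A_GL *)
Definition simple_GL (w : aff) : Prop :=
  (exists a b : 'I_n, b = a.+1 :> nat /\ w = refl a b 0) \/
  (exists a b : 'I_n, [/\ a = 0%N :> nat, b = n.-1 :> nat & w = refl a b (-1)]).

Definition omega (i : int) : {ffun 'I_n -> int} :=
  [ffun a : 'I_n => (if (a%:Z < (i %% n%:Z)%Z) then -1 else 0) - (i %/ n%:Z)%Z].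

Definition in_pmI (I : {set 'I_m.+1}) (i : int) : Prop :=
  exists j : 'I_m.+1, j \in I /\
    ((i %% n%:Z)%Z = ((j : nat)%:Z %% n%:Z)%Z \/ (i %% n%:Z)%Z = ((- (j : nat)%:Z) %% n%:Z)%Z).

Definition W_GL_pmI (I : {set 'I_m.+1}) (w : aff) : Prop :=
  forall i, in_pmI I i -> act_int w (omega i) = omega i.

Definition Adm_GL (I : {set 'I_m.+1}) (mu : {ffun 'I_n -> int}) (w : aff) : Prop :=
  exists s : {perm 'I_n},
    coset_le GLgrp simple_GL Omega_GL (W_GL_pmI I) w (transl (pact s mu)).

Definition in_Xstar (l : {ffun 'I_n -> int}) : Prop :=
  forall a b : 'I_n, l a + l (rv a) = l b + l (rv b).

Definition in_Sstar (s : {perm 'I_n}) : Prop :=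
  forall j : 'I_n, s (rv j) = rv (s j).

Definition GSpgrp (w : aff) : Prop := in_Xstar (tr w) /\ in_Sstar (pm w).

Definition in_V (x : 'I_n -> Rdefinitions.R) : Prop :=
  forall a b : 'I_n, x a + x (rv a) = x b + x (rv b).

Definition alcove_GSp (x : 'I_n -> Rdefinitions.R) : Prop :=
  [/\ in_V x,
      (forall a b : 'I_n, a = 0%N :> nat -> b = n.-1 :> nat -> x b - 1 < x a) &
      (forall a b : 'I_n, b = a.+1 :> nat -> (b <= m)%N -> x a < x b)].

Definition Omega_GSp (w : aff) : Prop :=
  GSpgrp w /\ forall x, in_V x -> (alcove_GSp x <-> alcove_GSp (act_R w x)).

(* reflections of V across the walls of A *)
Definition simple_GSp (w : aff) : Prop :=
  (exists a b : 'I_n, [/\ b = a.+1 :> nat, (b < m)%N &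
      w = amul (refl a b 0) (refl (rv b) (rv a) 0)]) \/
  (exists a b : 'I_n, [/\ a.+1 = m :> nat, b = m :> nat & w = refl a b 0]) \/
  (exists a b : 'I_n, [/\ a = 0%N :> nat, b = n.-1 :> nat & w = refl a b (-1)]).

Definition W_I (I : {set 'I_m.+1}) (w : aff) : Prop :=
  GSpgrp w /\ W_GL_pmI I w.

Definition Adm_GSp (I : {set 'I_m.+1}) (mu : {ffun 'I_n -> int}) (w : aff) : Prop :=
  exists s : {perm 'I_n}, in_Sstar s /\
    coset_le GSpgrp simple_GSp Omega_GSp (W_I I) w (transl (pact s mu)).

End GL_GSp.

(* Main.v *)
(* Write w(omega_i) for the vertices of the alcove of w and put
   D_ij(w) = sum_c max(0, w(omega_i)_c - omega_j,c).  For both groups,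
   x <= y on cosets holds iff x and y lie in the same component and
   D_ij(x) <= D_ij(y) for all j and all i in +-I: a simple reflection changes
   D_ij only for isolated j, between the two extreme values allowed by its
   neighbours D_i,j-1 and D_i,j+1, so this relation has the lifting property of
   the Bruhat order.  In particular the Bruhat order of GSp is the restriction of
   that of GL.  Conversely, if x in GSp satisfies D_ij(x) <= D_ij(t_{s mu}), then
   the case j = i - nk says that x(omega_i) - omega_i is dominated by mu.  Let
   b be the barycenter of the base alcove and choose v in S*_{2m} so that v mu is
   sorted like the coordinates of x(b) - b.  Then D_ij(x) is a sum over an initial
   segment of coordinates for that ordering, whence D_ij(x) <= D_ij(t_{v mu}). *)

Require Import Defs.
From HB Require Import structures.
From mathcomp Require Import all_boot all_order all_algebra all_fingroup.
From mathcomp Require Import zify ring lra.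
From mathcomp Require Import Rstruct.
From Stdlib Require Import Classical.
Set Implicit Arguments. Unset Strict Implicit. Unset Printing Implicit Defensive.
Import Order.TTheory GRing.Theory Num.Theory.
Local Open Scope ring_scope.

(** * Affine permutations *)

Section AffineGroup.
Variable n : nat.
Local Notation aff := (aff n).
Implicit Types (g u v w : aff) (a b c : 'I_n) (k : int).

Definition aid : aff := transl [ffun=> 0].

Lemma aff_ext w v :
  (forall a, tr w a = tr v a) -> (forall a, (pm w)^-1%g a = (pm v)^-1%g a) ->
  w = v.
Proof.
case: w v => [t p] [t' p'] /= et ep; congr Aff; first exact/ffunP.
by apply: invg_inj; apply/permP.
Qed.

Lemma amulA u v w : amul u (amul v w) = amul (amul u v) w.
Proof.
apply: aff_ext => a /=; rewrite ?ffunE /= ?mulgA //.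
by rewrite invMg permM addrA.
Qed.

Lemma aid_mul w : amul aid w = w.
Proof.
by apply: aff_ext => a /=; rewrite ?ffunE /= ?mulg1 // invg1 perm1 add0r.
Qed.

Lemma amul_id w : amul w aid = w.
Proof. by apply: aff_ext => a /=; rewrite ?ffunE /= ?mul1g // addr0. Qed.

Lemma ainv_mul w : amul (ainv w) w = aid.
Proof.
apply: aff_ext => a /=; rewrite ?ffunE /= ?mulgV //.
by rewrite invgK addNr.
Qed.

Lemma amul_inv w : amul w (ainv w) = aid.
Proof.
apply: aff_ext => a /=; rewrite ?ffunE /= ?mulVg //.
by rewrite -permM mulVg perm1 addrN.
Qed.

Lemma amulK u w : amul (ainv u) (amul u w) = w.
Proof. by rewrite amulA ainv_mul aid_mul. Qed.

Lemma amulVK u w : amul u (amul (ainv u) w) = w.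
Proof. by rewrite amulA amul_inv aid_mul. Qed.

Lemma amulI u v w : amul u v = amul u w -> v = w.
Proof. by move=> e; rewrite -(amulK u v) e amulK. Qed.

Lemma ainv_uniq u v : amul u v = aid -> ainv u = v.
Proof. by move=> e; apply: (@amulI u); rewrite e amul_inv. Qed.

Lemma ainvM u v : ainv (amul u v) = amul (ainv v) (ainv u).
Proof.
by apply: ainv_uniq; rewrite -amulA (amulA v) amul_inv aid_mul amul_inv.
Qed.

(* [win w] is [n] times the image under [w] of the point [(0, 1/n, ..., (n-1)/n)]
   of the base alcove; it is the window of the affine permutation [w^-1]. *)
Definition win w c : int := n%:Z * tr w c + ((pm w)^-1%g c : nat)%:Z.

Lemma win_id c : win aid c = (c : nat)%:Z.
Proof. by rewrite /win /= ffunE mulr0 add0r invg1 perm1. Qed.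

Lemma winM g u c : win (amul g u) c = n%:Z * tr g c + win u ((pm g)^-1%g c).
Proof. by rewrite /win /= ffunE invMg permM mulrDr addrA. Qed.

Lemma win_divmod w c (p : int) (q : 'I_n) :
  win w c = n%:Z * p + (q : nat)%:Z -> tr w c = p /\ (pm w)^-1%g c = q.
Proof.
rewrite /win => e; set r := (pm w)^-1%g c in e *.
have hr := ltn_ord r; have hq := ltn_ord q.
have ep : tr w c = p by nia.
by split=> //; apply: val_inj => /=; move: e; rewrite ep => e; lia.
Qed.

Lemma win_inj u v : win u =1 win v -> u = v.
Proof. by move=> e; apply: aff_ext => a; case: (win_divmod (e a)). Qed.

Lemma win_neq w a b k : a != b -> win w a - win w b - n%:Z * k != 0.
Proof.
move=> hab; apply/negP => /eqP e.
have [_ h] : tr w a = tr w b + k /\ (pm w)^-1%g a = (pm w)^-1%g b.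
  by apply: win_divmod; move: e; rewrite {2}/win mulrDr; lia.
by move: hab; rewrite (perm_inj h) eqxx.
Qed.

(** A geometric stand-in for length: through [dist_refl] it detects whether a mirror lies between
    two alcoves. *)
Definition dist u v : int := \sum_c (win u c - win v c) ^+ 2.

Lemma dist_ge0 u v : 0 <= dist u v.
Proof. by apply: sumr_ge0 => c _; exact: sqr_ge0. Qed.

Lemma distC u v : dist u v = dist v u.
Proof. by apply: eq_bigr => c _; ring. Qed.

Lemma dist_eq0 u v : dist u v = 0 -> u = v.
Proof.
move=> e; apply: win_inj => c.
have /psumr_eq0P/(_ c isT) : \sum_c (win u c - win v c) ^+ 2 = 0 by [].
move=> h; apply/eqP; rewrite -subr_eq0 -(sqrf_eq0 (_ - _)); apply/eqP; apply: h.
by move=> i _; exact: sqr_ge0.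
Qed.

Lemma distuu u : dist u u = 0.
Proof. by apply: big1 => c _; rewrite subrr expr0n. Qed.

Lemma distM g u v : dist (amul g u) (amul g v) = dist u v.
Proof.
rewrite /dist [RHS](reindex_inj (@perm_inj _ (pm g)^-1%g)).
by apply: eq_bigr => c _; rewrite !winM; ring.
Qed.

(** Up to the factor [n], the value of the affine root [x_a - x_b - k] at the alcove point of [u];
    its sign tells the side of the mirror. *)
Definition gap a b k u : int := win u a - win u b - n%:Z * k.

Lemma gapM g u a b k :
  gap a b k (amul g u) =
  gap ((pm g)^-1%g a) ((pm g)^-1%g b) (k - tr g a + tr g b) u.
Proof. by rewrite /gap !winM; ring. Qed.

Lemma win_refl a b k v c : a != b ->
  win (amul (refl a b k) v) c =
    if c == a then win v b + n%:Z * k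
    else if c == b then win v a - n%:Z * k else win v c.
Proof.
move=> hab; rewrite winM /= ffunE tpermV.
case: eqP => [->|/eqP ca]; first by rewrite tpermL addrC.
case: eqP => [->|/eqP cb]; first by rewrite tpermR; ring.
by rewrite tpermD 1?eq_sym // mulr0 add0r.
Qed.

Lemma refl_sqr a b k : a != b -> amul (refl a b k) (refl a b k) = aid.
Proof.
move=> hab; have hba : (b == a) = false by rewrite eq_sym (negPf hab).
apply: win_inj => c; rewrite -[X in amul _ X]amul_id !win_refl // !win_id.
rewrite hba !eqxx; case: eqP => [->|_]; first by ring.
by case: eqP => [->|//]; ring.
Qed.

(** The reflection moves the point of [v] by [gap a b k v] along a coroot of squared length 2. The
    difference is negative exactly when the mirror separates [u] from [v]. *)
Lemma dist_refl a b k u v : a != b ->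
  dist u (amul (refl a b k) v) - dist u v = 2 * gap a b k u * gap a b k v.
Proof.
move=> hab; rewrite /dist (bigD1 a) //= (bigD1 b) 1?eq_sym //=.
rewrite [X in _ - X](bigD1 a) //= [X in _ - (_ + X)](bigD1 b) 1?eq_sym //=.
rewrite (eq_bigr (fun c => (win u c - win v c) ^+ 2)); last first.
  by move=> c /andP[ca cb]; rewrite win_refl // (negPf ca) (negPf cb).
by rewrite !win_refl // !eqxx eq_sym (negPf hab) /gap; ring.
Qed.

(** A homomorphism to the integers that kills reflections; it labels the component of the Bruhat
    order. *)
Definition sumtr u : int := \sum_c tr u c.

Lemma sumtrM u v : sumtr (amul u v) = sumtr u + sumtr v.
Proof.
rewrite /sumtr [X in _ + X](reindex_inj (@perm_inj _ (pm u)^-1%g)) -big_split.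
by apply: eq_bigr => c _; rewrite ffunE.
Qed.

Lemma sumtr_refl a b k : a != b -> sumtr (refl a b k) = 0.
Proof.
move=> hab; rewrite /sumtr (bigD1 a) //= (bigD1 b) 1?eq_sym //= big1 => [|c].
  by rewrite !ffunE !eqxx eq_sym (negPf hab); ring.
by case/andP=> ca cb; rewrite ffunE (negPf ca) (negPf cb).
Qed.

Lemma sumtr_id : sumtr aid = 0.
Proof. by apply: big1 => c _; rewrite ffunE. Qed.

Lemma sumtr_inv u : sumtr (ainv u) = - sumtr u.
Proof. by apply/eqP; rewrite -addr_eq0 -sumtrM ainv_mul sumtr_id. Qed.

End AffineGroup.

(** * Vertex counts *)

Section VertexCount.
Variable n : nat.
Hypothesis n_gt1 : (1 < n)%N.
Local Notation aff := (aff n).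
Implicit Types (g u v w x y : aff) (a b c d : 'I_n) (i j k : int).

Lemma divz_bounds (e : int) :
  n%:Z * (e %/ n%:Z)%Z <= e < n%:Z * (e %/ n%:Z)%Z + n%:Z.
Proof.
have n0 : n%:Z != 0 by lia.
have := divz_eq e n%:Z; have := modz_ge0 e n0.
have := ltz_pmod e (_ : 0 < n%:Z); move=> /(_ ltac:(lia)).
by set q := (e %/ n)%Z; set r := (e %% n)%Z; move=> h1 h2 h3; apply/andP; lia.
Qed.

Lemma divz_uniq (e q : int) : n%:Z * q <= e < n%:Z * q + n%:Z ->
  (e %/ n%:Z)%Z = q.
Proof. by have := divz_bounds e; set p := (e %/ n)%Z => h1 h2; nia. Qed.

Lemma mul_neq1 (e : int) : n%:Z * e <> 1.
Proof. by move: n_gt1; case: (lerP e 0) => he; nia. Qed.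

Lemma ord_eqmod c d (e : int) : (c : nat)%:Z - (d : nat)%:Z = n%:Z * e -> c = d.
Proof.
have := ltn_ord c; have := ltn_ord d => hd hc h; apply: val_inj => /=.
have h0 : n%:Z * e < n%:Z * 1 by lia.
have h1 : n%:Z * (- e) < n%:Z * 1 by lia.
have n0 : 0 < n%:Z by lia.
move: h0 h1; rewrite !ltr_pM2l // => h0 h1.
have e0 : e = 0 by lia.
by move: h; rewrite e0; lia.
Qed.

(* Coordinate [c] of the image under [w] of the vertex [omega i]. *)
Definition vtx w i c : int := ((win w c - i) %/ n%:Z)%Z.

Lemma vtxM g u i c : vtx (amul g u) i c = tr g c + vtx u i ((pm g)^-1%g c).
Proof.
apply: divz_uniq; rewrite winM.
by have := divz_bounds (win u ((pm g)^-1%g c) - i); rewrite -/(vtx _ _ _); lia.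
Qed.

Lemma vtx_shift w i c k : vtx w (i - n%:Z * k) c = vtx w i c + k.
Proof.
by apply: divz_uniq; have := divz_bounds (win w c - i); rewrite -/(vtx _ _ _); lia.
Qed.

(** This is D_ij: [vtx (aid n) j] is the vertex omega_j. *)
Definition cnt i j w : int := \sum_c Num.max 0 (vtx w i c - vtx (aid n) j c).

(* [gap a b k] takes the value [-1] at [aid]; its zero locus is the wall of the
   base alcove containing all vertices [omega j] except those with [j] congruent
   to [a + 1] modulo [n]. *)
Definition elementary a b k : Prop := (b : nat)%:Z + n%:Z * k = (a : nat)%:Z + 1.

Section Elementary.
Variables (a b : 'I_n) (k : int).
Hypothesis el : elementary a b k.
Local Notation s := (refl a b k).

Lemma elementary_neq : a != b.
Proof.
apply/eqP => ab; move: el; rewrite /elementary ab => e.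
by apply: (@mul_neq1 k); lia.
Qed.
Let hab := elementary_neq.
Let hba : (b == a) = false. Proof. by rewrite eq_sym (negPf hab). Qed.

Lemma gap_aid : gap a b k (aid n) = -1.
Proof. by rewrite /gap !win_id; move: el; rewrite /elementary; lia. Qed.

Lemma cnt_split i j w : cnt i j w =
  \sum_(c | (c != a) && (c != b)) Num.max 0 (vtx w i c - vtx (aid n) j c) +
  Num.max 0 (vtx w i a - vtx (aid n) j a) +
  Num.max 0 (vtx w i b - vtx (aid n) j b).
Proof.
by rewrite /cnt (bigD1 a) //= (bigD1 b) 1?eq_sym //=; ring.
Qed.

Lemma vtx_b j : vtx (aid n) j b + k = (((a : nat)%:Z + 1 - j) %/ n%:Z)%Z.
Proof.
apply/esym/divz_uniq; rewrite /vtx win_id.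
by have := divz_bounds ((b : nat)%:Z - j); move: el; rewrite /elementary; lia.
Qed.

Lemma vtx_refl x i c : vtx (amul s x) i c =
  if c == a then vtx x i b + k else if c == b then vtx x i a - k else vtx x i c.
Proof.
rewrite vtxM /= ffunE tpermV.
case: eqP => [->|/eqP ca]; first by rewrite tpermL addrC.
case: eqP => [->|/eqP cb]; first by rewrite tpermR addrC.
by rewrite tpermD 1?eq_sym // add0r.
Qed.

Lemma cnt_refl i j x : cnt i j (amul s x) =
  \sum_(c | (c != a) && (c != b)) Num.max 0 (vtx x i c - vtx (aid n) j c) +
  Num.max 0 (vtx x i b + k - vtx (aid n) j a) +
  Num.max 0 (vtx x i a - k - vtx (aid n) j b).
Proof.
rewrite cnt_split !vtx_refl !eqxx hba; congr (_ + _ + _).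
by apply: eq_bigr => c /andP[ca cb]; rewrite vtx_refl (negPf ca) (negPf cb).
Qed.

Local Notation on_wall j := (~~ (n%:Z %| (a : nat)%:Z + 1 - j)%Z).

(** For [j] outside the class of [a + 1] the vertex omega_j lies on the wall, so [s] fixes it and
    merely exchanges the summands at [a] and [b]. *)
Lemma cnt_refl_fix i j x : on_wall j -> cnt i j (amul s x) = cnt i j x.
Proof.
move=> ow; rewrite cnt_refl cnt_split.
suff e : vtx (aid n) j a = vtx (aid n) j b + k.
  rewrite e -!addrA; congr (_ + _); rewrite addrC.
  by congr (Num.max _ _ + Num.max _ _); ring.
rewrite vtx_b /vtx win_id; apply: divz_uniq.
have := divz_bounds ((a : nat)%:Z + 1 - j); set q := (_ %/ _)%Z => /andP[h1 h2].
suff : n%:Z * q != (a : nat)%:Z + 1 - j by lia.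
by apply: contra ow => /eqP <-; apply: dvdz_mulr.
Qed.

(** Each of omega_(j-1) and omega_(j+1) differs from omega_j in a single coordinate, which is [a]
    and [b] respectively. *)
Lemma vtx_near j c (e : int) : c != a -> c != b ->
  (a : nat)%:Z + 1 - j = n%:Z * e ->
  vtx (aid n) (j - 1) c = vtx (aid n) j c /\
  vtx (aid n) (j + 1) c = vtx (aid n) j c.
Proof.
move=> ca cb he; rewrite /vtx win_id.
have := divz_bounds ((c : nat)%:Z - j); set q := (_ %/ _)%Z => /andP[h1 h2].
have na : (c : nat)%:Z - j + 1 != n%:Z * (q + 1).
  apply: contra ca => /eqP h; apply/eqP/(@ord_eqmod _ _ (q + 1 - e)).
  by rewrite mulrBr -h -he; ring.
have nb : (c : nat)%:Z - j != n%:Z * q.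
  apply: contra cb => /eqP h; apply/eqP/(@ord_eqmod _ _ (q - e + k)).
  move: el; rewrite /elementary => e0; rewrite mulrDr mulrBr -h -he.
  by rewrite (_ : n%:Z * k = (a : nat)%:Z + 1 - (b : nat)%:Z); [ring|lia].
by split; apply: divz_uniq; move: na; rewrite mulrDr mulr1; lia.
Qed.

(* With [A = z_a - q] and [B = z_b + k - q], the counts at [j - 1], [j], [j + 1]
   are up to a common term [(A-1)^+ + (B-1)^+], [A^+ + (B-1)^+] and
   [A^+ + B^+], and [s] swaps [A] and [B]. *)
Lemma cnt_up i j x : ~~ on_wall j -> gap a b k x < 0 ->
  [/\ cnt i j x = Num.max (cnt i (j - 1) x) (cnt i (j + 1) x - 1),
      cnt i j (amul s x) = Num.min (cnt i (j - 1) x + 1) (cnt i (j + 1) x) &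
      cnt i j x <= cnt i j (amul s x)].
Proof.
rewrite negbK => /dvdzP[e]; rewrite mulrC => he g0.
have near c (ca : c != a) (cb : c != b) := vtx_near ca cb he.
rewrite cnt_refl !cnt_split.
have -> : \sum_(c | (c != a) && (c != b))
    Num.max 0 (vtx x i c - vtx (aid n) (j - 1) c) =
  \sum_(c | (c != a) && (c != b)) Num.max 0 (vtx x i c - vtx (aid n) j c).
  by apply: eq_bigr => c /andP[ca cb]; rewrite (near c ca cb).1.
have -> : \sum_(c | (c != a) && (c != b))
    Num.max 0 (vtx x i c - vtx (aid n) (j + 1) c) =
  \sum_(c | (c != a) && (c != b)) Num.max 0 (vtx x i c - vtx (aid n) j c).
  by apply: eq_bigr => c /andP[ca cb]; rewrite (near c ca cb).2.
have va j' : vtx (aid n) j' a = (((a : nat)%:Z - j') %/ n%:Z)%Z.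
  by rewrite /vtx win_id.
have a0 : vtx (aid n) j a = e - 1.
  by rewrite va; apply: divz_uniq; move: n_gt1; nia.
have a1 : vtx (aid n) (j - 1) a = e.
  by rewrite va; apply: divz_uniq; move: n_gt1; nia.
have a2 : vtx (aid n) (j + 1) a = e - 1.
  by rewrite va; apply: divz_uniq; move: n_gt1; nia.
have b0 : vtx (aid n) j b = e - k.
  apply/eqP; rewrite eq_sym subr_eq eq_sym vtx_b; apply/eqP/divz_uniq.
  by move: n_gt1; nia.
have b1 : vtx (aid n) (j - 1) b = e - k.
  apply/eqP; rewrite eq_sym subr_eq eq_sym vtx_b; apply/eqP/divz_uniq.
  by move: n_gt1; nia.
have b2 : vtx (aid n) (j + 1) b = e - 1 - k.
  apply/eqP; rewrite eq_sym subr_eq eq_sym vtx_b; apply/eqP/divz_uniq.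
  by move: n_gt1; nia.
(* A negative gap says [win x a < win x b + n k]; taking floors keeps the weak inequality. *)
have ab : vtx x i a <= vtx x i b + k.
  move: g0; rewrite /gap /vtx.
  have := divz_bounds (win x a - i); have := divz_bounds (win x b - i).
  set p := (_ %/ _)%Z; set q := (_ %/ _)%Z => h1 h2 h3.
  by move: n_gt1; nia.
rewrite {}a0 {}a1 {}a2 {}b0 {}b1 {}b2; set R := \sum_(c | _) _.
move: (vtx x i a) (vtx x i b) ab => A B ab; clearbody R; clear -ab.
by split; lia.
Qed.

Lemma gap_refl x : gap a b k (amul s x) = - gap a b k x.
Proof. by rewrite /gap !win_refl // !eqxx hba; ring. Qed.

(** This is [cnt_up] for [s x], whose gap is negative, read backwards through the involution [s]. *)
Lemma cnt_down i j x : ~~ on_wall j -> 0 < gap a b k x ->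
  [/\ cnt i j x = Num.min (cnt i (j - 1) x + 1) (cnt i (j + 1) x),
      cnt i j (amul s x) = Num.max (cnt i (j - 1) x) (cnt i (j + 1) x - 1) &
      cnt i j (amul s x) <= cnt i j x].
Proof.
move=> ow g0; have [|h1 h2 h3] := @cnt_up i j (amul s x) ow.
  by rewrite gap_refl oppr_lt0.
rewrite amulA refl_sqr // aid_mul in h2 h3; move: ow; rewrite negbK => /dvdzP[e he].
(* Since [n > 1], the neighbours [j - 1] and [j + 1] are outside the class of [a + 1], so [s]
   preserves their counts. *)
have w1 : on_wall (j - 1).
  by apply/negP => /dvdzP[f hf]; apply: (@mul_neq1 (f - e)); lia.
have w2 : on_wall (j + 1).
  by apply/negP => /dvdzP[f hf]; apply: (@mul_neq1 (e - f)); lia.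
by move: h1 h2; rewrite !(cnt_refl_fix _ _ w1) !(cnt_refl_fix _ _ w2).
Qed.

Variable J : int -> Prop.
Definition cnt_le x y : Prop := forall i, J i -> forall j, cnt i j x <= cnt i j y.

Lemma gap_neg x : ~~ (0 < gap a b k x) -> gap a b k x < 0.
Proof. by rewrite -leNgt le_eqVlt (negPf (win_neq x k hab)). Qed.

(** The new counts at [j] are monotone functions of those at [j - 1] and [j + 1], which [s] leaves
    alone. *)
Lemma cnt_le_down_down x y : 0 < gap a b k x -> 0 < gap a b k y ->
  cnt_le x y -> cnt_le (amul s x) (amul s y).
Proof.
move=> gx gy h i Ji j; case: (boolP (on_wall j)) => ow.
  by rewrite !cnt_refl_fix //; exact: h.
have [_ -> _] := cnt_down i ow gx; have [_ -> _] := cnt_down i ow gy.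
by have := h i Ji (j - 1); have := h i Ji (j + 1); lia.
Qed.

Lemma cnt_le_up_down x y : gap a b k x < 0 -> 0 < gap a b k y ->
  cnt_le x y -> cnt_le x (amul s y).
Proof.
move=> gx gy h i Ji j; case: (boolP (on_wall j)) => ow.
  by rewrite cnt_refl_fix //; exact: h.
have [-> _ _] := cnt_up i ow gx; have [_ -> _] := cnt_down i ow gy.
by have := h i Ji (j - 1); have := h i Ji (j + 1); lia.
Qed.

(** When [s] moves [y] up, the count of [s y] at [j] is the largest that its neighbours allow, which
    bounds the counts of both [x] and [s x]. *)
Lemma cnt_le_up x y : gap a b k y < 0 -> cnt_le x y ->
  cnt_le (amul s x) (amul s y) /\ cnt_le x (amul s y).
Proof.
move=> gy h.
suff hi i j : J i -> cnt i j (amul s x) <= cnt i j (amul s y) /\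
    cnt i j x <= cnt i j (amul s y) by split=> i Ji j; case: (hi i j Ji).
move=> Ji; case: (boolP (on_wall j)) => ow.
  by rewrite !cnt_refl_fix //; split; exact: h.
have := h i Ji (j - 1); have := h i Ji (j + 1); have [_ -> _] := cnt_up i ow gy.
case: (boolP (0 < gap a b k x)) => gx.
  by have [] := cnt_down i ow gx; lia.
by have [] := cnt_up i ow (gap_neg gx); lia.
Qed.

End Elementary.

End VertexCount.

(** * Reflections, length and Bruhat order *)

Section Coxeter.
Variable n : nat.
Hypothesis n_gt1 : (1 < n)%N.
Local Notation aff := (aff n).
Variables G S Om : aff -> Prop.
Implicit Types (s t u v w : aff) (a b : 'I_n).

(* [t] acts as the reflection across the zero locus of [gap a b k];
   [C] is the squared length of its coroot. *)
Definition mirror t a b (k C : int) : Prop :=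
  [/\ a != b, 0 < C & forall u v, G u -> G v ->
    dist u (amul t v) - dist u v = C * gap a b k u * gap a b k v].

Hypothesis G_id : G (aid n).
Hypothesis G_mul : forall u v, G u -> G v -> G (amul u v).
Hypothesis G_inv : forall u, G u -> G (ainv u).
Hypothesis S_G : forall s, S s -> G s.
Hypothesis S_sqr : forall s, S s -> amul s s = aid n.
(** The last clause says that a single mirror lies between the base alcove and its neighbour. It
    compares products because a mirror fixes its root only up to sign, and values on [G] because
    distinct roots may agree there. *)
Hypothesis S_mirror : forall s, S s -> exists a b k C,
  mirror s a b k C /\
  forall a' b' k', a' != b' -> gap a' b' k' (aid n) * gap a' b' k' s < 0 ->
    forall u v, G u -> G v ->
      gap a' b' k' u * gap a' b' k' v = gap a b k u * gap a b k v.
Hypothesis Om_win : forall w, Om w -> exists x : int, forall c,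
  win w c = x + (c : nat)%:Z.
Hypothesis Om_G : forall w, Om w -> G w.
Hypothesis Om_of_minimal : forall w, G w ->
  (forall s, S s -> ~~ (dist (aid n) (amul s w) < dist (aid n) w)) -> Om w.

Local Notation T := (isrefl G S).

(* The mirror of the reflection [t] separates the alcoves of [u] and [v]. *)
Definition sep t u v : bool := dist u (amul t v) < dist u v.

Lemma T_G t : T t -> G t.
Proof. by case=> w [s [gw ss ->]]; do ?apply: G_mul => //; auto. Qed.

Lemma S_T s : S s -> T s.
Proof.
move=> ss; exists (aid n), s; split=> //.
by rewrite aid_mul (ainv_uniq (aid_mul _)) amul_id.
Qed.

Lemma T_conj t s : T t -> S s -> T (amul (amul s t) s).
Proof.
case=> w [r [gw sr ->]] ss; exists (amul s w), r; split=> //.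
  by apply: G_mul => //; exact: S_G.
by rewrite ainvM (ainv_uniq (S_sqr ss)) !amulA.
Qed.

Lemma S_mulK s w : S s -> amul s (amul s w) = w.
Proof. by move=> ss; rewrite amulA S_sqr // aid_mul. Qed.

Lemma T_mulK t w : T t -> amul t (amul t w) = w.
Proof.
by case=> g [s [gg ss ->]]; rewrite -!amulA amulK (S_mulK _ ss) amulVK.
Qed.

Lemma T_mirror t : T t -> exists a b k C, mirror t a b k C.
Proof.
case=> g [s [gg ss ->]]; have [a [b [k [C [[hab C0 h] _]]]]] := S_mirror ss.
exists (pm g a), (pm g b), (k + tr g (pm g a) - tr g (pm g b)), C.
split=> // [|u v gu gv]; first by rewrite (inj_eq perm_inj).
have gp w : gap (pm g a) (pm g b) (k + tr g (pm g a) - tr g (pm g b)) w =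
    gap a b k (amul (ainv g) w).
  by rewrite -{1}(amulVK g w) gapM !permK; congr (gap _ _ _ _); ring.
have gi := G_inv gg; rewrite !gp -h; [|exact: G_mul|exact: G_mul].
set u' := amul (ainv g) u; set v' := amul (ainv g) v.
by rewrite -(distM g u' v') -(distM g u' (amul s v')) !amulVK -!amulA.
Qed.

(** The side is the sign of [gap], which is never zero. Having two sides turns symmetry and
    additivity of [sep] into Boolean identities. *)
Lemma sep_side t : T t ->
  exists h : aff -> bool, forall u v, G u -> G v -> sep t u v = (h u != h v).
Proof.
move=> /T_mirror[a [b [k [C [hab C0 h]]]]].
exists (fun u => gap a b k u < 0) => u v gu gv; rewrite /sep -subr_lt0 h //.
have := win_neq v k hab; have := win_neq u k hab.
rewrite -/(gap a b k u) -/(gap a b k v) -mulrA pmulr_rlt0 //.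
move: (gap a b k u) (gap a b k v) => x y hx hy.
by case: (ltgtP x 0) hx => // x0 _; rewrite ?(nmulr_rlt0 _ x0) ?(pmulr_rlt0 _ x0);
  case: (ltgtP y 0) hy.
Qed.

Lemma sepC t u v : T t -> G u -> G v -> sep t u v = sep t v u.
Proof. by move=> /sep_side[h e] gu gv; rewrite !e // eq_sym. Qed.

Lemma sep_trans t u v w : T t -> G u -> G v -> G w ->
  sep t u w = sep t u v (+) sep t v w.
Proof.
move=> /sep_side[h e] gu gv gw; rewrite !e //.
by case: (h u) (h v) (h w) => [] [] [].
Qed.

Lemma sep_refl t u v : T t -> G u -> G v -> sep t u (amul t v) = ~~ sep t u v.
Proof.
move=> tt gu gv; have gtv := G_mul (T_G tt) gv.
rewrite (sep_trans tt gu gv gtv).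
suff -> : sep t v (amul t v) by rewrite addbT.
rewrite /sep T_mulK // distuu lt_neqAle dist_ge0 andbT eq_sym.
have [a [b [k [C [hab C0 h]]]]] := T_mirror tt.
apply/eqP => e; have := h v v gv gv; rewrite e distuu subrr.
have := win_neq v k hab; rewrite -/(gap a b k v) => g0 /esym/eqP.
by rewrite !mulf_eq0 (negPf g0) gt_eqF.
Qed.

Lemma sep_conj t s u v : S s ->
  sep (amul (amul s t) s) u v = sep t (amul s u) (amul s v).
Proof.
move=> ss; rewrite /sep -!amulA.
by rewrite -(distM s u (amul s _)) -(distM s u v) S_mulK.
Qed.

(** Otherwise the mirrors of [t] and [s] coincide by the uniqueness clause of [S_mirror], and then
    the two reflections are equal. *)
Lemma sep_S t s : T t -> S s -> t <> s -> sep t (aid n) s = false.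
Proof.
move=> tt ss ts; apply/negP => o; apply: ts.
have [a' [b' [k' [C' [hab' C0' h']]]]] := T_mirror tt.
have [a [b [k [C [[hab C0 h] uniq]]]]] := S_mirror ss.
have gs := S_G ss; have gt := T_G tt.
have e : forall u v, G u -> G v ->
    gap a' b' k' u * gap a' b' k' v = gap a b k u * gap a b k v.
  apply: uniq => //; move: o; rewrite /sep -subr_lt0 h' //.
  by rewrite -mulrA pmulr_rlt0.
apply: dist_eq0; have X0 := dist_ge0 t s.
have d1 := dist_ge0 s (aid n); have d2 := dist_ge0 t (aid n).
have e1 := h s _ gs G_id; have e2 := h' s _ gs G_id.
have e3 := h t _ gt G_id; have e4 := h' t _ gt G_id.
move: e1 e2 e3 e4; rewrite !amul_id !distuu -!mulrA !e // (distC s t).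
move: (dist t s) (dist s _) (dist t _) X0 d1 d2 => X ds dt X0 d1 d2.
move: (gap a b k s * _) (gap a b k t * _) => p q e1 e2 e3 e4.
(* The equations give [X = (C' - C) * p = (C - C') * q] with [p] and [q] nonpositive, so [X <= 0]
   whichever of [C] and [C'] is larger. *)
by case: (leP C C') => hC; nia.
Qed.

(** * Word length and the exchange condition *)

Lemma wordlen_G w k : wordlen S Om w k -> G w.
Proof. by elim=> [v /Om_G|s v j ss _ gv] //; apply: G_mul => //; exact: S_G. Qed.

(** Strong exchange: if [t] is not the leading letter [s], its mirror does not separate the base
    alcove from [s]. Then [s t s] separates the base alcove from the rest of the word, and induction
    applies. *)
Lemma exchange w k t : wordlen S Om w k -> T t -> sep t (aid n) w ->
  exists2 j, (j < k)%N & wordlen S Om (amul t w) j.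
Proof.
move=> wl; elim: wl t => [v ov|s v j ss wv IH] t tt.
  have [a [b [i [C [hab C0 h]]]]] := T_mirror tt.
  rewrite /sep -subr_lt0 h //; last exact: Om_G.
  have [x hx] := Om_win ov.
  (* An element of [Om] shifts the whole window by a constant, so every root keeps its value at the
     base alcove. *)
  have -> : gap a b i v = gap a b i (aid n).
    by rewrite /gap !hx !win_id; ring.
  by rewrite ltNge -mulrA mulr_ge0 ?(ltW C0) // -expr2 sqr_ge0.
have gv := wordlen_G wv; have gs := S_G ss.
case: (classic (t = s)) => [->|ts] o; first by exists j; rewrite // S_mulK.
have o' : sep (amul (amul s t) s) (aid n) v.
  move: o; rewrite (sep_trans tt G_id gs (G_mul gs gv)) (sep_S tt ss ts) /=.
  by rewrite sep_conj // amul_id.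
have [i lij wi] := IH _ (T_conj tt ss) o'.
exists i.+1 => //; suff -> : amul t (amul s v) =
  amul s (amul (amul (amul s t) s) v) by exact: wlS.
by rewrite -!amulA S_mulK.
Qed.

(** A simple reflection that brings the alcove closer lowers the integer [dist]; once none does,
    [Om_of_minimal] applies. *)
Lemma wordlen_ex w : G w -> exists k, wordlen S Om w k.
Proof.
have [N] := ubnP `|dist (aid n) w|%N; elim: N w => // N IH w hN gw.
case: (classic (exists2 s, S s & dist (aid n) (amul s w) < dist (aid n) w)).
  move=> [s ss lt]; have [|k wk] := IH (amul s w) _ (G_mul (S_G ss) gw).
    by have := dist_ge0 (aid n) (amul s w); lia.
  by exists k.+1; rewrite -(S_mulK w ss); apply: wlS.
move=> no; exists 0%N; apply/wl0/Om_of_minimal => // s ss; apply/negP => h.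
by apply: no; exists s.
Qed.

Lemma length_ex w : G w -> exists k, length_is S Om w k.
Proof.
move=> /wordlen_ex[k]; elim/ltn_ind: k => k IH wk.
case: (classic (exists2 j, (j < k)%N & wordlen S Om w j)) => [[j jk wj]|no].
  exact: IH wj.
exists k; split=> // j wj; rewrite leqNgt; apply/negP => jk.
by apply: no; exists j.
Qed.

Lemma len_ltP u v : len_lt S Om u v -> ~ len_lt S Om v u.
Proof.
move=> [k [k' [[a1 a2] [b1 b2] c]]] [j [j' [[d1 d2] [e1 e2] f]]].
by have := e2 _ a1; have := b2 _ d1; lia.
Qed.

Lemma sep_len_lt t w : T t -> G w -> sep t (aid n) w ->
  len_lt S Om (amul t w) w.
Proof.
move=> tt gw o; have [k [wk mk]] := length_ex gw.
have [j jk wj] := exchange wk tt o.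
have [i [wi mi]] := length_ex (G_mul (T_G tt) gw).
by exists i, k; split=> //; apply: leq_ltn_trans jk; exact: mi.
Qed.

Lemma len_ltE t w : T t -> G w ->
  len_lt S Om w (amul t w) <-> ~~ sep t (aid n) w.
Proof.
move=> tt gw; split=> [l|o]; first by apply/negP => /(sep_len_lt tt gw)/len_ltP.
have := @sep_len_lt t (amul t w) tt (G_mul (T_G tt) gw).
by rewrite sep_refl // T_mulK //; exact.
Qed.

Lemma Om_no_sep w t : T t -> Om w -> sep t (aid n) w = false.
Proof. by move=> tt ow; apply/negP => /(exchange (wl0 S ow) tt) [j]. Qed.

(** * Lifting properties of the Bruhat order *)

Local Notation le := (bruhat G S Om).

Lemma bruhat_G u v : le u v -> G u /\ G v.
Proof. by elim=> [w //|a b t _ [ga gb] /T_G gt _]; auto. Qed.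

Lemma bruhat_step u v t : le u v -> T t -> sep t (aid n) v = false ->
  le u (amul t v).
Proof.
move=> uv tt o; have [gu gv] := bruhat_G uv; apply: br_step => //.
by apply/len_ltE => //; rewrite o.
Qed.

Lemma bruhat_stepV u v t : T t -> G v -> sep t (aid n) v -> le u (amul t v) ->
  le u v.
Proof.
move=> tt gv o uv; rewrite -(T_mulK v tt); apply: bruhat_step => //.
by rewrite sep_refl // o.
Qed.

(* Both lifting properties come down to this: unless [t = s], a step [v < tv]
   turns into the step [sv < (sts)sv]. *)
Lemma bruhat_step_S u v t s : T t -> S s -> t <> s -> G v ->
  sep t (aid n) v = false -> le u (amul s v) -> le u (amul s (amul t v)).
Proof.
move=> tt ss ts gv o uv; have gs := S_G ss.
have -> : amul s (amul t v) = amul (amul (amul s t) s) (amul s v).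
  by rewrite -!amulA S_mulK.
apply: bruhat_step => //; first exact: T_conj.
rewrite sep_conj // S_mulK // amul_id sepC //.
by rewrite (sep_trans tt gv G_id gs) (sep_S tt ss ts) sepC // o.
Qed.

(** Induction on the chain from [u] to [v]: a step by [s] itself yields the first alternative, and
    any other step preserves whichever alternative holds. *)
Lemma bruhat_S_lift u v s : S s -> le u v -> le u (amul s v) \/
  le (amul s u) (amul s v).
Proof.
move=> ss; elim=> [w gw|w x t wx IH tt l].
  by right; apply: br_refl; apply: G_mul => //; exact: S_G.
have [gw gx] := bruhat_G wx; move/len_ltE: (l) => /(_ tt gx)/negPf o.
case: (classic (t = s)) => [->|ts]; first by left; rewrite S_mulK.
by case: IH => IH; [left | right]; exact: bruhat_step_S.
Qed.

Lemma bruhat_S_mul u v s : S s -> le u v -> le (amul s u) v \/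
  le (amul s u) (amul s v).
Proof.
move=> ss; elim=> [w gw|w x t wx IH tt l].
  by right; apply: br_refl; apply: G_mul => //; exact: S_G.
have [gw gx] := bruhat_G wx; move/len_ltE: (l) => /(_ tt gx)/negPf o.
case: IH => IH; first by left; exact: bruhat_step.
case: (classic (t = s)) => [->|ts]; first by left.
by right; exact: bruhat_step_S.
Qed.

Lemma bruhat_Om u v : Om v -> le u v -> u = v.
Proof.
move=> + uv; case: uv => [w gw|w x t wx tt l] //.
have [gw gx] := bruhat_G wx; move/(Om_no_sep tt).
by rewrite sep_refl //; move/len_ltE: l => /(_ tt gx) ->.
Qed.

Lemma sep_or_Om w : G w -> (exists2 s, S s & sep s (aid n) w) \/ Om w.
Proof.
move=> gw; case: (classic (exists2 s, S s & sep s (aid n) w)); first by left.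
move=> no; right; apply: Om_of_minimal => // s ss; apply/negP => o.
by apply: no; exists s.
Qed.

(** Induction on word length through left descents, which exist for every element outside [Om]. *)
Lemma bruhat_ind_S (P : aff -> Prop) :
  (forall v, Om v -> P v) ->
  (forall s v, S s -> G v -> sep s (aid n) v -> P (amul s v) -> P v) ->
  forall v, G v -> P v.
Proof.
move=> P0 PS v gv; have [k wk] := wordlen_ex gv.
elim/ltn_ind: k v gv wk => k IH v gv wk.
have [[s ss o]|/P0 //] := sep_or_Om gv.
have [j jk wj] := exchange wk (S_T ss) o.
by apply: (PS s) => //; apply: IH wj => //; apply: G_mul => //; exact: S_G.
Qed.

(** * Minimal coset representatives *)

Lemma minrep_ex (P : aff -> Prop) w : P (aid n) -> G w ->
  exists v, minrep G S Om P w v.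
Proof.
move=> P1 gw; pose Q k := exists v, [/\ G v, in_coset P w v & length_is S Om v k].
have [k0 hk0] : exists k, Q k.
  have [k lk] := length_ex gw; exists k, w; split=> //.
  by rewrite /in_coset ainv_mul.
have [k [v [gv cv lv]] mk] : exists2 k, Q k & forall j, Q j -> (k <= j)%N.
  elim/ltn_ind: k0 hk0 => k IH qk.
  case: (classic (exists2 j, (j < k)%N & Q j)) => [[j jk /IH] |no]; first exact.
  exists k => // j qj; rewrite leqNgt; apply/negP => jk.
  by apply: no; exists j.
exists v; split=> // u gu cu; have [j lj] := length_ex gu.
by exists k, j; split=> //; apply: mk; exists u.
Qed.

(** For [u] in the coset of [s x], the element [s u] lies in that of [x]. With l the length, l(sx) <
    l(x) <= l(su) <= l(u) + 1. *)
Lemma minrep_S (P : aff -> Prop) s x : S s -> G x -> sep s (aid n) x ->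
  minrep G S Om P x x -> minrep G S Om P (amul s x) (amul s x).
Proof.
move=> ss gx o [_ cx mx]; have gs := S_G ss.
have e u v : amul (ainv (amul s u)) v = amul (ainv u) (amul s v).
  by rewrite ainvM (ainv_uniq (S_sqr ss)) amulA.
split; [by auto|by rewrite /in_coset e S_mulK|move=> u gu].
rewrite /in_coset e => /(mx _ (G_mul gs gu)).
have [j [j' [[wj mj] [wj' mj'] lj]]] := sep_len_lt (S_T ss) gx o.
have [i li] := length_ex gu.
move=> [q [q' [[wq mq] [wq' mq'] lq]]].
exists j, i; split=> //; have := mj' _ wq; have := mq' _ (wlS ss (proj1 li)).
by lia.
Qed.

(** * The Bruhat order in terms of vertex counts *)

Hypothesis S_sumtr : forall s, S s -> sumtr s = 0.
Hypothesis S_cnt : forall (J : int -> Prop) s x y, S s -> G x -> G y ->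
  cnt_le J x y ->
  [/\ sep s (aid n) x -> sep s (aid n) y -> cnt_le J (amul s x) (amul s y),
      ~~ sep s (aid n) x -> sep s (aid n) y -> cnt_le J x (amul s y) &
      ~~ sep s (aid n) y ->
        cnt_le J (amul s x) (amul s y) /\ cnt_le J x (amul s y)].

Lemma sumtr_bruhat u v : le u v -> sumtr u = sumtr v.
Proof.
elim=> // {}u {}v t _ -> [g [s [_ ss ->]]] _.
by rewrite !sumtrM sumtr_inv (S_sumtr ss); ring.
Qed.

(** Induction on left descents of [v]: lifting replaces [v] by [s v] and [u] by [u] or [s u], and
    the last clause of [S_cnt] leads back. *)
Lemma cnt_le_bruhat (J : int -> Prop) u v : le u v -> cnt_le J u v.
Proof.
move=> uv; have [_ gv] := bruhat_G uv; move: v gv u uv.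
apply: bruhat_ind_S => [v ov u /(bruhat_Om ov) -> //|s v ss gv o IH u uv].
have gs := S_G ss; have gsv := G_mul gs gv; have [gu _] := bruhat_G uv.
have o' : ~~ sep s (aid n) (amul s v) by rewrite sep_refl ?o //; exact: S_T.
case: (bruhat_S_lift ss uv) => /IH h.
  by have [_ _ /(_ o')[_]] := S_cnt ss gu gsv h; rewrite S_mulK.
by have [_ _ /(_ o')[]] := S_cnt ss (G_mul gs gu) gsv h; rewrite !S_mulK.
Qed.

Lemma sum_vtx w i : \sum_c vtx w i c = sumtr w + \sum_c vtx (aid n) i c.
Proof.
rewrite -{1}[w]amul_id.
under eq_bigr => c _ do rewrite vtxM //.
rewrite big_split; congr (_ + _).
by rewrite [RHS](reindex_inj (@perm_inj _ (pm w)^-1%g)).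
Qed.

(** Sum over the window: the residues run once through [0, ..., n - 1] and cancel, leaving
    [n x = n sumtr w]. *)
Lemma win_shift_sumtr w (x : int) :
  (forall c, win w c = x + (c : nat)%:Z) -> x = sumtr w.
Proof.
move=> h; have : \sum_(c < n) win w c = \sum_(c < n) (x + (c : nat)%:Z).
  by apply: eq_bigr.
rewrite /win !big_split /= sumr_const card_ord -mulr_sumr -/(sumtr w).
rewrite [X in _ + X = _](_ : _ = \sum_(c < n) (c : nat)%:Z); last first.
  by rewrite [RHS](reindex_inj (@perm_inj _ (pm w)^-1%g)).
move/addIr; rewrite -mulr_natl natz => /mulfI -> //.
by apply/eqP; move: n_gt1; lia.
Qed.

Variables (J : int -> Prop) (P : aff -> Prop).
Hypothesis P_stab : forall w, P w <->
  G w /\ forall i, J i -> vtx w i =1 vtx (aid n) i.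

Lemma in_coset_vtx w v : G w -> G v ->
  in_coset P w v <-> forall i, J i -> vtx w i =1 vtx v i.
Proof.
move=> gw gv; rewrite /in_coset P_stab; split=> [[_ h] i Ji c|h].
  by rewrite -{1}(amul_id w) -(amulVK w v) !(vtxM n_gt1 w) h.
split=> [|i Ji c]; first by apply: G_mul => //; exact: G_inv.
by rewrite -(ainv_mul w) !(vtxM n_gt1 (ainv w)) h.
Qed.

Lemma in_coset_cnt w v : (exists i, J i) -> G w -> G v -> in_coset P w v ->
  sumtr w = sumtr v /\ forall i, J i -> forall j, cnt i j w = cnt i j v.
Proof.
move=> [i0 Ji0] gw gv /(in_coset_vtx gw gv) wv; split=> [|i Ji j].
  apply: (@addIr _ (\sum_c vtx (aid n) i0 c)).
  by rewrite -(sum_vtx w) -(sum_vtx v); apply: eq_bigr => c _; exact: wv.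
by apply: eq_bigr => c _; rewrite wv.
Qed.

Lemma minrep_self w v : G w -> minrep G S Om P w v -> minrep G S Om P v v.
Proof.
move=> gw [gv /in_coset_vtx wv mv]; split=> //; first exact/in_coset_vtx.
move=> u gu /in_coset_vtx vu; apply: mv => //; apply/in_coset_vtx => // i Ji c.
by rewrite wv // vu.
Qed.

(** Induction on left descents of [y], with [S_cnt] as the lifting property of counts. In the base
    case the counts force [x] into the coset of [y], and minimality forces it into [Om]. *)
Lemma bruhat_of_cnt_le y : G y -> (exists i, J i) ->
  forall x, minrep G S Om P x x -> sumtr x = sumtr y -> cnt_le J x y -> le x y.
Proof.
move=> gy J0; move: y gy; apply: bruhat_ind_S => [y oy|s y ss gy o IH] x mx sxy xy.
  have [gx _ mx'] := mx; have gy := Om_G oy; have [p hp] := Om_win oy.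
  have e i : J i -> vtx x i =1 vtx y i.
    move=> Ji; have hy c : vtx y i c = vtx (aid n) (i - p) c.
      by rewrite /vtx hp win_id; congr (_ %/ _)%Z; ring.
    (* The image of omega_i under [y] is omega_(i-p), so this choice of [j] makes the count of [y]
       vanish. *)
    have y0 : cnt i (i - p) y = 0.
      by apply: big1 => c _; rewrite hy subrr maxxx.
    have le_xy c : vtx x i c <= vtx y i c.
      rewrite hy -subr_le0.
      have := xy i Ji (i - p); rewrite y0 /cnt (bigD1 c) //=.
      have : 0 <= \sum_(d < n | d != c)
        Num.max 0 (vtx x i d - vtx (aid n) (i - p) d).
        by apply: sumr_ge0 => d _; rewrite le_max lexx.
      by set R := \sum_(d < n | _) _; lia.
    (* Coordinatewise inequality and equal coordinate sums together force equality. *)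
    have s0 : \sum_c (vtx y i c - vtx x i c) = 0.
      by rewrite sumrB (sum_vtx y) (sum_vtx x) sxy subrr.
    have h : forall d : 'I_n, true -> 0 <= vtx y i d - vtx x i d.
      by move=> d _; rewrite subr_ge0.
    by move=> c; have /eqP := psumr_eq0P h s0 (i := c) isT;
      rewrite subr_eq0 => /eqP.
  (* Now [y] lies in the coset of [x] and has length zero, hence so has the minimal representative
     [x]. *)
  have [k [k' [[wk mk] [wk' mk'] lk]]] := mx' y gy ((in_coset_vtx gx gy).2 e).
  have ox : Om x.
    have k0 : k = 0%N by have := mk' _ (wl0 S oy); lia.
    by move: wk; rewrite k0 => w0; inversion w0.
  have [q hq] := Om_win ox.
  suff -> : x = y by apply: br_refl.
  apply: win_inj => c; rewrite hq hp; congr (_ + _).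
  by rewrite (win_shift_sumtr hq) (win_shift_sumtr hp).
have gs := S_G ss; have gsy := G_mul gs gy; have [gx _ _] := mx.
have osy : sep s (aid n) (amul s y) = false by rewrite sep_refl ?o //; exact: S_T.
have up u : le u (amul s y) -> le u y.
  by move=> h; apply: (bruhat_stepV (S_T ss)).
have ssy : sumtr (amul s y) = sumtr y by rewrite sumtrM S_sumtr // add0r.
have [dd ud _] := S_cnt ss gx gy xy.
case: (boolP (sep s (aid n) x)) => ox; last first.
  by apply/up/IH => //; [rewrite ssy | exact: ud].
have ssx : sumtr (amul s x) = sumtr x by rewrite sumtrM S_sumtr // add0r.
have := IH (amul s x) (minrep_S ss gx ox mx); rewrite ssx ssy => /(_ sxy (dd ox o)).
move/(bruhat_S_mul ss); rewrite !S_mulK //; case=> //; exact: up.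
Qed.

(* [cnt i j w] is the number of positions by which the lattice of [w (omega i)]
   exceeds that of [omega j]; this is the rank-matrix form of the Bruhat order. *)
Lemma coset_leP w w' : G w -> G w' -> (exists i, J i) ->
  coset_le G S Om P w w' <-> sumtr w = sumtr w' /\ cnt_le J w w'.
Proof.
move=> gw gw' J0.
have same u v : G u -> minrep G S Om P u v ->
    sumtr u = sumtr v /\ forall i, J i -> forall j, cnt i j u = cnt i j v.
  by move=> gu [gv uv _]; exact: in_coset_cnt.
split=> [[v [v' [mv mv' l]]]|[st h]].
  have [e1 c1] := same _ _ gw mv; have [e2 c2] := same _ _ gw' mv'.
  split; first by rewrite e1 e2; exact: sumtr_bruhat.
  by move=> i Ji j; rewrite c1 // c2 //; exact: (cnt_le_bruhat l Ji).
have P1 : P (aid n) by apply/P_stab.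
have [v mv] := minrep_ex P1 gw; have [v' mv'] := minrep_ex P1 gw'.
exists v, v'; split=> //.
have [e1 c1] := same _ _ gw mv; have [e2 c2] := same _ _ gw' mv'.
apply: bruhat_of_cnt_le => //; first by case: mv'.
- exact: minrep_self mv.
- by rewrite -e1 -e2.
- by move=> i Ji j; rewrite -c1 // -c2 //; exact: h.
Qed.

End Coxeter.

(** * Simple reflections and alcoves *)

Section SimpleReflections.
Variable n : nat.
Hypothesis n_gt1 : (1 < n)%N.
Local Notation aff := (aff n).
Implicit Types (g u v w x y : aff) (a b c d : 'I_n) (i j k : int).

Lemma refl_sym a b k : a != b -> refl a b k = refl b a (- k).
Proof.
move=> hab; have hba : b != a by rewrite eq_sym.
apply: win_inj => c; rewrite -[refl a b k]amul_id -[refl b a _]amul_id !win_refl //.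
case: (altP (c =P a)) => [->|_]; first by rewrite (negPf hab); ring.
by case: eqP => // _; ring.
Qed.

Lemma elementary_cases a b k : elementary a b k ->
  (k = 0 /\ b = a.+1 :> nat) \/ [/\ k = 1, b = 0%N :> nat & a = n.-1 :> nat].
Proof.
rewrite /elementary => e; have := ltn_ord a; have := ltn_ord b => hb ha.
have k0 : 0 <= k by rewrite leNgt; apply/negP => hk; nia.
have k1 : k <= 1 by rewrite leNgt; apply/negP => hk; nia.
have [k_0|k_1] : k = 0 \/ k = 1 by lia.
  by left; split=> //; move: e; rewrite k_0; lia.
by right; move: e; rewrite k_1; split=> //; lia.
Qed.

Lemma sep_elementary a b k x : elementary a b k ->
  sep (refl a b k) (aid n) x = (0 < gap a b k x).
Proof.
move=> el; rewrite /sep -subr_lt0 dist_refl ?(gap_aid n_gt1 el) //.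
  by rewrite mulrN1 mulNr oppr_lt0 pmulr_rgt0.
exact: (elementary_neq n_gt1 el).
Qed.

Lemma win_elementary a b k c : elementary a b k ->
  win (refl a b k) c = (c : nat)%:Z + (c == a)%:Z - (c == b)%:Z.
Proof.
move=> el; have hab := elementary_neq n_gt1 el.
rewrite -[refl a b k]amul_id win_refl // !win_id; move: el; rewrite /elementary.
case: (altP (c =P a)) => [-> h|_ h]; first by rewrite (negPf hab); lia.
by case: (altP (c =P b)) => [->|_]; lia.
Qed.

(** The window increases strictly and spreads over less than [n], so its [n] integers are
    consecutive. *)
Lemma win_of_elementary w :
  (forall a b k, elementary a b k -> gap a b k w < 0) ->
  exists p : int, forall c, win w c = p + (c : nat)%:Z.
Proof.
move=> h; have n0 : (0 < n)%N by exact: ltnW.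
pose z := Ordinal n0; have nl : (n.-1 < n)%N by rewrite prednK.
pose l := Ordinal nl.
have up c d : d = c.+1 :> nat -> win w c + 1 <= win w d.
  move=> e; have : gap c d 0 w < 0 by apply: h; rewrite /elementary; lia.
  by rewrite /gap; lia.
have mono (e : nat) c d : d = (c + e)%N :> nat -> win w c + e%:Z <= win w d.
  elim: e d => [|e IH] d hd.
    suff -> : d = c by rewrite addr0.
    by apply: val_inj => /=; lia.
  have hd' : (c + e < n)%N by have := ltn_ord d; lia.
  have := IH (Ordinal hd') erefl; have := up (Ordinal hd') d.
  by move=> /(_ ltac:(move=> /=; lia)); lia.
have last : win w l < win w z + n%:Z.
  by have := h l z 1; rewrite /elementary /gap /=; lia.
exists (win w z) => c; have hc := ltn_ord c.
have := mono c z c erefl; have := mono (n.-1 - c)%N c l.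
by move=> /(_ ltac:(move=> /=; lia)); lia.
Qed.

Lemma S_cnt_elementary (J : int -> Prop) a b k x y :
  elementary a b k -> cnt_le J x y ->
  [/\ 0 < gap a b k x -> 0 < gap a b k y ->
        cnt_le J (amul (refl a b k) x) (amul (refl a b k) y),
      ~~ (0 < gap a b k x) -> 0 < gap a b k y ->
        cnt_le J x (amul (refl a b k) y) &
      ~~ (0 < gap a b k y) ->
        cnt_le J (amul (refl a b k) x) (amul (refl a b k) y) /\
        cnt_le J x (amul (refl a b k) y)].
Proof.
move=> el h; split=> [hx hy|hx hy|hy].
- exact: cnt_le_down_down.
- by apply: cnt_le_up_down => //; exact: gap_neg.
- by apply: cnt_le_up => //; exact: gap_neg.
Qed.

Lemma mirror_refl (G : aff -> Prop) a b k : a != b ->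
  mirror G (refl a b k) a b k 2.
Proof. by move=> hab; split=> // u v _ _; exact: dist_refl. Qed.

End SimpleReflections.

(** * Alcoves and their stabilizers *)

Section Alcoves.
Variable n : nat.
Hypothesis n_gt1 : (1 < n)%N.
Local Notation aff := (aff n).
Local Notation R := Rdefinitions.R.
Implicit Types (w : aff) (a b c : 'I_n).

(* [alcove_GL] for an index bound that need not be even *)
Definition alcove (x : 'I_n -> R) : Prop :=
  (forall a b, b = a.+1 :> nat -> x a < x b) /\
  (forall a b, a = 0%N :> nat -> b = n.-1 :> nat -> x b < x a + 1).

Lemma alcove_elementary x : alcove x <->
  forall a b (k : int), elementary a b k -> x a < x b + k%:~R.
Proof.
split=> [[h1 h2] a b k /(elementary_cases n_gt1)[[-> e]|[-> b0 al]]|h].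
- by rewrite addr0; exact: h1.
- exact: h2.
split=> [a b e|a b a0 bl].
  by have := h a b 0; rewrite addr0; apply; rewrite /elementary; lia.
by apply: (h b a 1); rewrite /elementary; have := ltn_ord b; lia.
Qed.

(** The barycenter of the base alcove up to a multiple of (1, ..., 1). Its image under [w],
    multiplied by [n], is [win w]; this links real alcoves to integer windows. *)
Definition barycenter a : R := (a : nat)%:R / n%:R.

Lemma act_barycenter w a : act_R w barycenter a = (win w a)%:~R / n%:R.
Proof.
have n0 : n%:R != 0 :> R by rewrite pnatr_eq0; lia.
by rewrite /act_R /barycenter /win rmorphD rmorphM /= mulrDl mulrAC divff // mul1r.
Qed.

Lemma alcove_act_barycenter w : alcove (act_R w barycenter) ->
  exists p : int, forall c, win w c = p + (c : nat)%:Z.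
Proof.
move/alcove_elementary => h; apply: win_of_elementary => // a b k /h.
have n0 : 0 < n%:R :> R by rewrite ltr0n; lia.
rewrite !act_barycenter -(ltr_pM2r n0) mulrDl !divfK ?gt_eqF // -subr_lt0.
by rewrite /gap -(ltr_int R) !rmorphB rmorphM /= opprD addrA mulrC.
Qed.

(** Such a [w] permutes the walls: each elementary inequality at the image pulls back to another
    elementary inequality. *)
Lemma act_R_shift w (p : int) : (forall c, win w c = p + (c : nat)%:Z) ->
  forall x, alcove x -> alcove (act_R w x).
Proof.
move=> hw x /alcove_elementary h; apply/alcove_elementary => a b k el.
have := h ((pm w)^-1 a)%g ((pm w)^-1 b)%g (k + tr w b - tr w a).
have ea := hw a; have eb := hw b; rewrite /elementary /win in el ea eb *.
move=> /(_ ltac:(lia)); rewrite /act_R rmorphB rmorphD /=.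
by move: (x _) (x _) (k%:~R) ((tr w b)%:~R) ((tr w a)%:~R) => X Y K A B; lra.
Qed.

Lemma win_shift_inv w (p : int) : (forall c, win w c = p + (c : nat)%:Z) ->
  forall c, win (ainv w) c = - p + (c : nat)%:Z.
Proof.
move=> hw c; have := win_id c; rewrite -(ainv_mul w) winM hw => h.
by rewrite /win; lia.
Qed.

Lemma act_RK w x : act_R (ainv w) (act_R w x) =1 x.
Proof.
move=> a; rewrite /act_R /= ffunE invgK permK rmorphN /=.
by rewrite addrA addNr add0r.
Qed.

Lemma alcove_shift_iff w (p : int) : (forall c, win w c = p + (c : nat)%:Z) ->
  forall x, alcove x <-> alcove (act_R w x).
Proof.
move=> hw x; split=> [|/(act_R_shift (win_shift_inv hw))]; first exact: (act_R_shift hw).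
by case=> h1 h2; split=> a b; rewrite -!(act_RK w x); auto.
Qed.

Lemma alcove_barycenter : alcove barycenter.
Proof.
have n0 : 0 < n%:R :> R by rewrite ltr0n; lia.
apply/alcove_elementary => a b k; rewrite /elementary => e.
rewrite /barycenter -(ltr_pM2r n0) mulrDl !divfK ?gt_eqF //.
have : (a : nat)%:Z < (b : nat)%:Z + n%:Z * k by lia.
by rewrite -(ltr_int R) rmorphD rmorphM /= [n%:R * _]mulrC.
Qed.

End Alcoves.

(** * The general linear group *)

(** Crossing one wall changes the integer value of a root by at most 2, so a change of sign is
    possible only in the extreme cases. *)
Lemma sign_change (X d : int) : X != 0 -> X * (X + d) < 0 -> -2 <= d <= 2 ->
  (X = -1 /\ d = 2) \/ (X = 1 /\ d = -2).
Proof.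
move=> X0 h /andP[d1 d2]; case: (ltgtP X 0) X0 => // hX _.
  by move: h; rewrite nmulr_rlt0 // => h; lia.
by move: h; rewrite pmulr_rlt0 // => h; lia.
Qed.

Section GL.
Variable m : nat.
Hypothesis m_gt0 : (1 <= m)%N.
Local Notation n := (m.*2).
Local Notation aff := (aff n).
Implicit Types (g u v w x y : aff) (a b c d : 'I_n).

Lemma double_gt1 : (1 < n)%N. Proof. by lia. Qed.
Local Notation n_gt1 := double_gt1.

Lemma omegaE (i : int) c : omega m i c = vtx (aid n) i c.
Proof.
rewrite /omega ffunE /vtx win_id; apply/esym/(divz_uniq n_gt1).
have n0 : n%:Z != 0 by move: n_gt1; lia.
have := divz_eq i n%:Z; have := modz_ge0 i n0; have := ltn_ord c.
have := ltz_pmod i (_ : 0 < n%:Z); move=> /(_ ltac:(move: n_gt1; lia)).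
set q := (i %/ _)%Z; set r := (i %% _)%Z => h1 h2 h3 ->.
by rewrite !mulrBr; case: ifP => hc; lia.
Qed.

Lemma act_omega w (i : int) c : act_int w (omega m i) c = vtx w i c.
Proof. by rewrite /act_int ffunE omegaE -vtxM ?amul_id //; exact: n_gt1. Qed.

Lemma W_GL_pmI_vtx (I : {set 'I_m.+1}) w :
  W_GL_pmI I w <-> forall i, in_pmI I i -> vtx w i =1 vtx (aid n) i.
Proof.
split=> h i /h; first by move=> e c; rewrite -act_omega e omegaE.
by move=> e; apply/ffunP => c; rewrite act_omega e omegaE.
Qed.

Lemma in_pmI_ex (I : {set 'I_m.+1}) : I != set0 -> exists i, in_pmI I i.
Proof. by case/set0Pn => j Ij; exists (j : nat)%:Z, j; split=> //; left. Qed.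

Lemma simple_GL_elementary w : simple_GL w <->
  exists a b (k : int), elementary a b k /\ w = refl a b k.
Proof.
split=> [[[a [b [e ->]]]|[a [b [a0 bl ->]]]]|[a [b [k [el ->]]]]].
- by exists a, b, 0; split=> //; rewrite /elementary; lia.
- have el : elementary b a 1.
    by rewrite /elementary; have := ltn_ord b; lia.
  exists b, a, 1; split=> //; apply: refl_sym.
  by rewrite eq_sym; exact: (elementary_neq n_gt1 el).
case: (elementary_cases n_gt1 el) => [[-> e]|[k1 b0 al]].
  by left; exists a, b.
right; exists b, a; split=> //; rewrite k1; apply: refl_sym.
exact: (elementary_neq n_gt1 el).
Qed.

Lemma Omega_GL_win w : Omega_GL w <->
  exists p : int, forall c, win w c = p + (c : nat)%:Z.
Proof.
split=> [h|[p hp] x]; last exact: (alcove_shift_iff n_gt1 hp).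
apply: (alcove_act_barycenter n_gt1).
exact: (h _).1 (alcove_barycenter n_gt1).
Qed.

Lemma mul_neq0_cancel (k k' : int) : n%:Z * k = n%:Z * k' -> k = k'.
Proof. by apply: mulfI; move: n_gt1; lia. Qed.

(** By [win_elementary] the root changes by [d], a signed count of coincidences of indices. A change
    of sign needs [d] to be 2 or -2, and then the root is that of the wall up to sign. *)
Lemma elementary_separates (G : aff -> Prop) a b (k : int) a' b' (k' : int) :
  elementary a b k -> a' != b' ->
  gap a' b' k' (aid n) * gap a' b' k' (refl a b k) < 0 ->
  forall u v, G u -> G v ->
    gap a' b' k' u * gap a' b' k' v = gap a b k u * gap a b k v.
Proof.
move=> el hab'; have X0 := win_neq (aid n) k' hab'.
pose d := (a' == a)%:Z - (a' == b)%:Z - (b' == a)%:Z + (b' == b)%:Z.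
have -> : gap a' b' k' (refl a b k) = gap a' b' k' (aid n) + d.
  by rewrite /gap !(win_elementary n_gt1 _ el) !win_id /d; ring.
move=> h u v _ _; have [] := sign_change X0 h _.
- by rewrite /d; lia.
- case=> e1 e2; have /andP[/eqP ea /eqP eb] : (a' == a) && (b' == b).
    by move: e2; rewrite /d; lia.
  move: e1 el; rewrite ea eb /elementary !win_id => e1 el.
  suff -> : k' = k by [].
  by apply: mul_neq0_cancel; lia.
- case=> e1 e2; have /andP[/eqP ea /eqP eb] : (a' == b) && (b' == a).
    by move: e2; rewrite /d; lia.
  move: e1 el; rewrite ea eb /elementary !win_id => e1 el.
  have -> : k' = - k by apply: mul_neq0_cancel; lia.
  by rewrite /gap; ring.
Qed.

Lemma GL_coset_leP (I : {set 'I_m.+1}) w w' : I != set0 ->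
  coset_le (@GLgrp m) (@simple_GL m) (@Omega_GL m) (W_GL_pmI I) w w' <->
  sumtr w = sumtr w' /\ cnt_le (in_pmI I) w w'.
Proof.
move=> I0; apply: (coset_leP n_gt1) => //; last exact: in_pmI_ex.
- move=> s /simple_GL_elementary[a [b [k [el ->]]]]; apply: refl_sqr.
  exact: (elementary_neq n_gt1 el).
- move=> s /simple_GL_elementary[a [b [k [el ->]]]]; exists a, b, k, 2; split.
    by apply: mirror_refl; exact: (elementary_neq n_gt1 el).
  by move=> a' b' k' ab' h u v; exact: elementary_separates.
- by move=> v /Omega_GL_win.
- move=> v _ h; apply/Omega_GL_win/(win_of_elementary n_gt1) => a b k el.
  apply: (gap_neg n_gt1 el); rewrite -sep_elementary //; last exact: n_gt1.
  by apply: h; apply/simple_GL_elementary; exists a, b, k.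
- move=> s /simple_GL_elementary[a [b [k [el ->]]]]; apply: sumtr_refl.
  exact: (elementary_neq n_gt1 el).
- move=> J s x y /simple_GL_elementary[a [b [k [el ->]]]] _ _ h.
  rewrite !(sep_elementary n_gt1 _ el).
  by have [] := S_cnt_elementary n_gt1 el h.
- move=> v; rewrite W_GL_pmI_vtx; split=> [//|[]//].
Qed.

End GL.

(** * The group of symplectic similitudes *)

Section GSp.
Variable m : nat.
Hypothesis m_gt0 : (1 <= m)%N.
Local Notation n := (m.*2).
Local Notation aff := (aff n).
Implicit Types (g u v w x y : aff) (a b c d : 'I_n).
Local Notation n_gt1 := (double_gt1 m_gt0).

Lemma rvK : involutive (@rv m). Proof. exact: rev_ordK. Qed.

Lemma rv_val c : (rv c : nat)%:Z = n%:Z - 1 - (c : nat)%:Z.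
Proof. by rewrite /rv /=; have := ltn_ord c; lia. Qed.

Lemma eq_rv a b : (rv a == b) = (a == rv b).
Proof. by rewrite -{1}(rvK b) (inj_eq (inv_inj rvK)). Qed.

Lemma rv_neq a : rv a != a.
Proof. by apply/eqP => /(congr1 (fun c : 'I_n => (c : nat)%:Z)); rewrite rv_val; lia. Qed.

Lemma in_Sstar_inv (s : {perm 'I_n}) : in_Sstar s -> in_Sstar s^-1%g.
Proof. by move=> h j; apply: (@perm_inj _ s); rewrite h !permKV. Qed.

Lemma GSp_perm w c : GSpgrp w -> (pm w)^-1%g (rv c) = rv ((pm w)^-1%g c).
Proof. by case=> _ /in_Sstar_inv. Qed.

Lemma GSp_id : GSpgrp (aid n).
Proof. by split=> [a b|j] /=; rewrite ?ffunE ?perm1. Qed.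

Lemma GSp_mul u v : GSpgrp u -> GSpgrp v -> GSpgrp (amul u v).
Proof.
move=> gu gv; split=> [a b|j] /=.
  rewrite !ffunE !(GSp_perm _ gu); have := gu.1 a b.
  by have := gv.1 ((pm u)^-1%g a) ((pm u)^-1%g b); lia.
by rewrite !permM gv.2 gu.2.
Qed.

Lemma GSp_inv u : GSpgrp u -> GSpgrp (ainv u).
Proof.
move=> gu; split=> [a b|] /=; last exact: in_Sstar_inv gu.2.
by rewrite !ffunE !gu.2; have := gu.1 (pm u a) (pm u b); lia.
Qed.

Lemma GSp_win u a b : GSpgrp u ->
  win u a + win u (rv a) = win u b + win u (rv b).
Proof.
move=> gu; rewrite /win !(GSp_perm _ gu) !rv_val.
by have := congr1 (fun z => n%:Z * z) (gu.1 a b); rewrite !mulrDr; lia.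
Qed.

Lemma gap_rv a b (k : int) u : GSpgrp u ->
  gap (rv b) (rv a) k u = gap a b k u.
Proof. by move=> gu; rewrite /gap; have := GSp_win a b gu; lia. Qed.

Lemma elementary_rv a b (k : int) :
  elementary a b k -> elementary (rv b) (rv a) k.
Proof. by rewrite /elementary !rv_val; lia. Qed.

(* The simple reflection of [GSp] whose mirror is the zero locus of
   [gap a b k] in [V]. *)
Definition srefl a b (k : int) : aff :=
  if b == rv a then refl a b k
  else amul (refl a b k) (refl (rv b) (rv a) k).

(** * Products of two commuting reflections *)

Section DoubleReflection.
Variables (a b : 'I_n) (k : int).
Hypotheses (el : elementary a b k) (brv : b != rv a).
Local Notation r1 := (refl a b k).
Local Notation r2 := (refl (rv b) (rv a) k).

Let hab : a != b. Proof. exact: (elementary_neq n_gt1 el). Qed.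
Let hab' : rv b != rv a.
Proof. by rewrite (inj_eq (inv_inj rvK)) eq_sym. Qed.
Let h1 : a != rv b. Proof. by rewrite -eq_rv eq_sym. Qed.
Let h2 : a != rv a. Proof. by rewrite eq_sym rv_neq. Qed.
Let h3 : b != rv b. Proof. by rewrite eq_sym rv_neq. Qed.

(** The affine wall has [a = n - 1] and [b = 0], that is [b = rv a], which [brv] excludes. *)
Lemma double_k0 : k = 0.
Proof.
case: (elementary_cases n_gt1 el) => [[]//|[_ b0 al]].
case/eqP: brv; apply: val_inj => /=; rewrite b0 al; lia.
Qed.

(** The indices [a], [b], [rv a], [rv b] are distinct here, so the two mirrors are orthogonal. *)
Lemma gap_double v : gap a b k (amul r2 v) = gap a b k v.
Proof.
by rewrite /gap !win_refl // (negPf h1) (negPf h2) (negPf h3) (negPf brv).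
Qed.

Lemma doubleC : amul r1 r2 = amul r2 r1.
Proof.
apply: win_inj => c.
rewrite -[amul r1 r2]amul_id -[amul r2 r1]amul_id -!amulA !win_refl // !win_id.
rewrite ![rv b == _]eq_sym ![rv a == _]eq_sym.
rewrite (negPf h1) (negPf h2) (negPf h3) (negPf brv).
have [->|ca] := eqVneq c a.
  by rewrite (negPf h1) (negPf h2).
have [->|cb] := eqVneq c b.
  by rewrite (negPf h3) (negPf brv).
by [].
Qed.

Lemma win_double c : win (amul r1 r2) c = (c : nat)%:Z
  + ((c == a)%:Z + (c == rv b)%:Z - (c == b)%:Z - (c == rv a)%:Z).
Proof.
rewrite win_refl // !(win_elementary n_gt1 _ (elementary_rv el)).
rewrite (negPf h1) (negPf h2) (negPf h3) (negPf brv).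
move: el; rewrite /elementary.
have [->|ca] := eqVneq c a.
  by rewrite (negPf h1) (negPf h2) (negPf hab); lia.
have [->|cb] := eqVneq c b.
  by rewrite (negPf h3) (negPf brv); lia.
by lia.
Qed.

Lemma GSp_double : GSpgrp (amul r1 r2).
Proof.
have rvt c d j : rv (tperm c d j) = tperm (rv c) (rv d) (rv j).
  by apply: inj_tperm; exact: inv_inj rvK.
split=> [c d|j] /=; first by rewrite !ffunE double_k0 oppr0 !if_same.
rewrite !permM !rvt !rvK.
have := congr1 (fun u => pm u (rv j)) doubleC; rewrite /= !permM => ->.
by rewrite [tperm (rv b) _]tpermC [tperm b a]tpermC.
Qed.

Lemma double_sqr : amul (amul r1 r2) (amul r1 r2) = aid n.
Proof.
by rewrite {2}doubleC -amulA (amulA r2) refl_sqr // aid_mul refl_sqr.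
Qed.

(** Two orthogonal reflections contribute 2 each, since their roots agree on [GSpgrp] by
    [gap_rv]. *)
Lemma dist_double u v : GSpgrp u -> GSpgrp v ->
  dist u (amul (amul r1 r2) v) - dist u v = 4 * gap a b k u * gap a b k v.
Proof.
move=> gu gv; have e1 := dist_refl k u (amul r2 v) hab.
have e2 := dist_refl k u v hab'; rewrite gap_double in e1.
rewrite !gap_rv // in e2; rewrite -amulA.
by rewrite -[LHS](subrKA (dist u (amul r2 v))) e1 e2; ring.
Qed.

(** The displacement [e] lies between -1 and 1, so a change of sign requires it to be 1 at one of
    [a'], [b'] and -1 at the other. *)
Lemma double_separates a' b' (k' : int) : a' != b' ->
  gap a' b' k' (aid n) * gap a' b' k' (amul r1 r2) < 0 ->
  forall u v, GSpgrp u -> GSpgrp v ->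
    gap a' b' k' u * gap a' b' k' v = gap a b k u * gap a b k v.
Proof.
move=> ab'; have X0 := win_neq (aid n) k' ab'.
pose e c := (c == a)%:Z + (c == rv b)%:Z - (c == b)%:Z - (c == rv a)%:Z.
have e_pos c : e c <= 1 /\ (e c = 1 -> c = a \/ c = rv b).
  rewrite /e; have [->|_] := eqVneq c a.
    by rewrite (negPf h1) (negPf h2) (negPf hab); split=> //; left.
  by have [->|_] := eqVneq c (rv b); split=> [|h]; [lia|by right|lia|exfalso; lia].
have e_neg c : -1 <= e c /\ (e c = -1 -> c = b \/ c = rv a).
  rewrite /e; have [->|_] := eqVneq c b.
    by rewrite (negPf h3) (negPf brv) [b == a]eq_sym (negPf hab); split=> //; left.
  by have [->|_] := eqVneq c (rv a); split=> [|h]; [lia|by right|lia|exfalso; lia].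
have -> : gap a' b' k' (amul r1 r2) = gap a' b' k' (aid n) + (e a' - e b').
  by rewrite /gap !win_double !win_id /e; ring.
move=> h u v gu gv.
have [a1 a2] := e_pos a'; have [a3 a4] := e_neg a'.
have [b1 b2] := e_pos b'; have [b3 b4] := e_neg b'.
(* [gap c d k'] takes the value [-1] at [aid] for [c] and [d] with
   [e c = 1] and [e d = -1] only if [d] follows [c]. *)
have key c d (l : int) : (c = a \/ c = rv b) -> (d = b \/ d = rv a) ->
    (c : nat)%:Z - (d : nat)%:Z - n%:Z * l = -1 ->
    forall w, GSpgrp w -> gap c d l w = gap a b k w.
  move=> hc hd e1 w gw; move: (el); rewrite /elementary => e0.
  have lk : n%:Z * l = n%:Z * k -> l = k by exact: mul_neq0_cancel.
  case: hc hd e1 => -> [->|->] e1.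
  - by rewrite lk //; lia.
  (* The two mixed pairs are impossible, as they would give [b = rv a]. *)
  - case/eqP: brv; apply: (ord_eqmod n_gt1 (e := l - k)); rewrite mulrBr.
    by lia.
  - case/eqP: brv; apply/esym; rewrite -(rvK b); congr (rv _).
    by apply: (ord_eqmod n_gt1 (e := k - l)); rewrite mulrBr; lia.
  - by rewrite lk ?gap_rv //; move: e1; rewrite !rv_val; lia.
case: (sign_change X0 h); first by apply/andP; lia.
- case=> e1 e2; have ha : a' = a \/ a' = rv b by apply: a2; lia.
  have hb : b' = b \/ b' = rv a by apply: b4; lia.
  by move: e1; rewrite !win_id => e1; rewrite !(key a' b').
- case=> e1 e2; have ha : b' = a \/ b' = rv b by apply: b2; lia.
  have hb : a' = b \/ a' = rv a by apply: a4; lia.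
  have e3 w : gap a' b' k' w = - gap b' a' (- k') w by rewrite /gap; ring.
  move: e1; rewrite !win_id => e1; rewrite !e3 mulrNN.
  by rewrite !(key b' a' (- k')) //; lia.
Qed.

(** Apply the statement for one reflection to [r2] and then to [r1]. Both roots agree on [GSpgrp]
    and [r2] preserves the root of [r1], so both applications fall into the same case. *)
Lemma S_cnt_double (J : int -> Prop) x y : GSpgrp x -> GSpgrp y ->
  cnt_le J x y ->
  [/\ 0 < gap a b k x -> 0 < gap a b k y ->
        cnt_le J (amul (amul r1 r2) x) (amul (amul r1 r2) y),
      ~~ (0 < gap a b k x) -> 0 < gap a b k y ->
        cnt_le J x (amul (amul r1 r2) y) &
      ~~ (0 < gap a b k y) ->
        cnt_le J (amul (amul r1 r2) x) (amul (amul r1 r2) y) /\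
        cnt_le J x (amul (amul r1 r2) y)].
Proof.
move=> gx gy h; rewrite -!amulA.
have [dd ud up] := S_cnt_elementary n_gt1 (elementary_rv el) h.
rewrite !gap_rv // in dd ud up; split=> [hx hy|hx hy|hy].
- have [] := S_cnt_elementary n_gt1 el (dd hx hy).
  by rewrite !gap_double => dd' _ _; exact: dd'.
- have [] := S_cnt_elementary n_gt1 el (ud hx hy).
  by rewrite !gap_double => _ ud' _; exact: ud'.
have [u1 u2] := up hy.
have [_ _] := S_cnt_elementary n_gt1 el u1.
have [_ _] := S_cnt_elementary n_gt1 el u2.
by rewrite !gap_double => /(_ hy)[_ p1] /(_ hy)[p2 _].
Qed.

End DoubleReflection.

Section SimpleReflection.
Variables (a b : 'I_n) (k : int).
Hypothesis el : elementary a b k.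
Let hab : a != b. Proof. exact: (elementary_neq n_gt1 el). Qed.

Lemma GSp_srefl : GSpgrp (srefl a b k).
Proof.
rewrite /srefl; case: eqP => [e|/eqP]; last exact: GSp_double.
have rab : rv b = a by rewrite e rvK.
split=> [c d|j] /=; last first.
  by rewrite (inj_tperm _ _ _ (inv_inj rvK)) -e rab tpermC.
rewrite !ffunE.
have h f : (if f == a then k else if f == b then - k else 0) +
   (if rv f == a then k else if rv f == b then - k else 0) = 0.
  rewrite !eq_rv -e rab; have [->|fa] := eqVneq f a.
    by rewrite (negPf hab) subrr.
  by case: eqP => _; rewrite ?addNr ?addr0.
by rewrite !h.
Qed.

Lemma srefl_sqr : amul (srefl a b k) (srefl a b k) = aid n.
Proof.
rewrite /srefl; case: eqP => [_|/eqP h]; first exact: refl_sqr.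
exact: double_sqr.
Qed.

Lemma sumtr_srefl : sumtr (srefl a b k) = 0.
Proof.
rewrite /srefl; case: eqP => _; rewrite ?sumtrM ?sumtr_refl ?addr0 //.
by rewrite (inj_eq (inv_inj rvK)) eq_sym.
Qed.

Lemma mirror_srefl : exists C, mirror (@GSpgrp m) (srefl a b k) a b k C.
Proof.
rewrite /srefl; case: eqP => [_|/eqP h]; first by exists 2; exact: mirror_refl.
by exists 4; split=> // u v gu gv; exact: dist_double.
Qed.

Lemma sep_srefl x : GSpgrp x ->
  sep (srefl a b k) (aid n) x = (0 < gap a b k x).
Proof.
move=> gx; have [C [_ C0 h]] := mirror_srefl.
rewrite /sep -subr_lt0 h //; last exact: GSp_id.
by rewrite (gap_aid n_gt1 el) mulrN1 mulNr oppr_lt0 pmulr_rgt0.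
Qed.

Lemma srefl_separates a' b' (k' : int) : a' != b' ->
  gap a' b' k' (aid n) * gap a' b' k' (srefl a b k) < 0 ->
  forall u v, GSpgrp u -> GSpgrp v ->
    gap a' b' k' u * gap a' b' k' v = gap a b k u * gap a b k v.
Proof.
move=> ab'; rewrite /srefl; case: eqP => [_|/eqP h] s.
  exact: elementary_separates.
exact: (double_separates el h ab' s).
Qed.

Lemma S_cnt_srefl (J : int -> Prop) x y : GSpgrp x -> GSpgrp y ->
  cnt_le J x y ->
  [/\ 0 < gap a b k x -> 0 < gap a b k y ->
        cnt_le J (amul (srefl a b k) x) (amul (srefl a b k) y),
      ~~ (0 < gap a b k x) -> 0 < gap a b k y ->
        cnt_le J x (amul (srefl a b k) y) &
      ~~ (0 < gap a b k y) ->
        cnt_le J (amul (srefl a b k) x) (amul (srefl a b k) y) /\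
        cnt_le J x (amul (srefl a b k) y)].
Proof.
move=> gx gy h; rewrite /srefl; case: eqP => [_|/eqP hb].
  exact: (S_cnt_elementary n_gt1 el h).
exact: (S_cnt_double el hb gx gy h).
Qed.

End SimpleReflection.

Lemma simple_GSp_srefl s : simple_GSp s ->
  exists a b (k : int), elementary a b k /\ s = srefl a b k.
Proof.
case=> [[a [b [e bm ->]]]|[[a [b [am bm ->]]]|[a [b [a0 bl ->]]]]].
- exists a, b, 0; split; first by rewrite /elementary; lia.
  rewrite /srefl ifN //; apply/eqP => h.
  by have := congr1 (fun c : 'I_n => (c : nat)%:Z) h; rewrite rv_val; lia.
- exists a, b, 0; split; first by rewrite /elementary; lia.
  by rewrite /srefl ifT //; apply/eqP/val_inj => /=; lia.
have el : elementary b a 1 by rewrite /elementary; have := ltn_ord b; lia.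
exists b, a, 1; split=> //; rewrite /srefl ifT.
  by apply: refl_sym; rewrite eq_sym; exact: (elementary_neq n_gt1 el).
by apply/eqP/val_inj => /=; have := ltn_ord b; lia.
Qed.

(** Roots past the middle are covered by their images under [rv], which have the same mirror in
    V. *)
Lemma srefl_simple_GSp a b (k : int) : elementary a b k ->
  simple_GSp (srefl a b k) \/ simple_GSp (srefl (rv b) (rv a) k).
Proof.
move=> el; have hab := elementary_neq n_gt1 el.
have hba : b != a by rewrite eq_sym.
case: (elementary_cases n_gt1 el) => [[k0 e]|[k1 b0 al]]; last first.
  have h : b = rv a by apply: val_inj => /=; lia.
  left; right; right; rewrite /srefl h eqxx -h; exists b, a; split=> //.
  by rewrite refl_sym // k1.
case: (ltngtP b m) => hb.
- left; left; exists a, b; rewrite k0; split=> //; rewrite /srefl ifN //.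
  apply/eqP => h.
  by have := congr1 (fun c : 'I_n => (c : nat)%:Z) h; rewrite rv_val; lia.
- right; left; exists (rv b), (rv a); have := ltn_ord b => hbn.
  split; [by rewrite /=; lia|by rewrite /=; lia|].
  rewrite k0 /srefl ifN //; apply/eqP => h.
  by have := congr1 (fun c : 'I_n => (c : nat)%:Z) h; rewrite !rv_val; lia.
left; right; left; exists a, b; rewrite k0; split=> //; first by lia.
by rewrite /srefl ifT //; apply/eqP/val_inj => /=; lia.
Qed.

(** The inequalities past the middle follow from those before it, because [x_a + x_(rv a)] is
    constant. *)
Lemma alcove_GSp_iff (x : 'I_n -> Rdefinitions.R) :
  alcove_GSp x <-> in_V x /\ @alcove n x.
Proof.
split=> [[V h0 h]|[V [h h0]]]; last first.
  split=> // [a b a0 bl|a b e _]; last exact: h.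
  by rewrite ltrBlDr; exact: h0.
split=> //; split=> [a b e|a b a0 bl]; last by rewrite -ltrBlDr; exact: h0.
case: (leqP b m) => hb; first exact: h.
have hbn := ltn_ord b.
have := h (rv b) (rv a); move=> /(_ ltac:(move=> /=; lia) ltac:(move=> /=; lia)).
have := V a b.
by move: (x a) (x b) (x (rv a)) (x (rv b)) => A B C D; lra.
Qed.

Lemma in_V_act w (x : 'I_n -> Rdefinitions.R) :
  GSpgrp w -> in_V x -> in_V (act_R w x).
Proof.
move=> gw V a b; rewrite /act_R !(GSp_perm _ gw).
have := V ((pm w)^-1%g a) ((pm w)^-1%g b).
have := congr1 (fun z : int => z%:~R : Rdefinitions.R) (gw.1 a b).
rewrite !rmorphD /=; set A := (tr w a)%:~R; set B := (tr w (rv a))%:~R.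
set C := (tr w b)%:~R; set D := (tr w (rv b))%:~R.
move: A B C D (x ((pm w)^-1%g a)) (x ((pm w)^-1%g b))
  (x (rv ((pm w)^-1%g a))) (x (rv ((pm w)^-1%g b))) => A B C D X Y Z W; lra.
Qed.

Lemma in_V_barycenter : in_V (@barycenter n).
Proof.
move=> a b; rewrite /barycenter -!mulrDl -!natrD; congr (_%:R / _).
by rewrite /=; have := ltn_ord a; have := ltn_ord b; lia.
Qed.

Lemma Omega_GSp_win w : Omega_GSp w <->
  GSpgrp w /\ exists p : int, forall c, win w c = p + (c : nat)%:Z.
Proof.
split=> [[gw h]|[gw [p hp]]]; split=> //.
  apply: (alcove_act_barycenter n_gt1).
  have /alcove_GSp_iff[] // : alcove_GSp (act_R w (@barycenter n)).
  apply: (h _ in_V_barycenter).1; apply/alcove_GSp_iff; split.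
    exact: in_V_barycenter.
  exact: (alcove_barycenter n_gt1).
move=> x V; rewrite !alcove_GSp_iff (alcove_shift_iff n_gt1 hp).
by split=> [] [_ A]; split=> //; exact: in_V_act.
Qed.

(** The right-hand side is that of [GL_coset_leP], so the two Bruhat orders agree on cosets of
    elements of [GSpgrp]. *)
Lemma GSp_coset_leP (I : {set 'I_m.+1}) w w' : I != set0 ->
  GSpgrp w -> GSpgrp w' ->
  coset_le (@GSpgrp m) (@simple_GSp m) (@Omega_GSp m) (W_I I) w w' <->
  sumtr w = sumtr w' /\ cnt_le (in_pmI I) w w'.
Proof.
move=> I0 gw gw'; apply: (coset_leP n_gt1) => //; last exact: in_pmI_ex.
- exact: GSp_id.
- exact: GSp_mul.
- exact: GSp_inv.
- by move=> s /simple_GSp_srefl[a [b [k [el ->]]]]; exact: GSp_srefl.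
- by move=> s /simple_GSp_srefl[a [b [k [el ->]]]]; exact: srefl_sqr.
- move=> s /simple_GSp_srefl[a [b [k [el ->]]]].
  have [C hC] := mirror_srefl el; exists a, b, k, C; split=> //.
  by move=> a' b' k' ab' h u v; exact: srefl_separates.
- by move=> v /Omega_GSp_win[].
- by move=> v /Omega_GSp_win[].
- move=> v gv h; apply/Omega_GSp_win; split=> //.
  apply: (win_of_elementary n_gt1) => a b k el; apply: (gap_neg n_gt1 el).
  case: (srefl_simple_GSp el) => /h.
    by rewrite -/(sep _ _ _) sep_srefl.
  by rewrite -/(sep _ _ _) sep_srefl ?gap_rv //; exact: elementary_rv.
- by move=> s /simple_GSp_srefl[a [b [k [el ->]]]]; exact: sumtr_srefl.
- move=> J s x y /simple_GSp_srefl[a [b [k [el ->]]]] gx gy h.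
  rewrite !sep_srefl //; exact: S_cnt_srefl.
- by move=> v; rewrite /W_I W_GL_pmI_vtx.
Qed.

End GSp.

(** * Comparison *)

Section Comparison.
Variable m : nat.
Hypothesis m_gt0 : (1 <= m)%N.
Local Notation n := (m.*2).
Local Notation aff := (aff n).
Implicit Types (g u v w x y : aff) (a b c d : 'I_n).
Local Notation n_gt1 := (double_gt1 m_gt0).

(** Take the rank of each coordinate. By the hypothesis [rv] reverses the order, so the ranks of [c]
    and [rv c] add up to [n - 1]. *)
Lemma sorting_perm (f : 'I_n -> int) :
  (forall a b, f a + f (rv a) = f b + f (rv b)) ->
  exists2 r : {perm 'I_n}, in_Sstar r & forall c d, f c < f d -> (r c < r d)%N.
Proof.
(* Ties of [f] are broken by the index, whose order [rv] reverses too. *)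
move=> fV; pose key c := n%:Z * f c + (c : nat)%:Z.
have key_inj : injective key.
  move=> c d; rewrite /key => e; apply: (ord_eqmod n_gt1 (e := f d - f c)).
  by rewrite mulrBr; lia.
pose below c := [set d | key d < key c].
have below_lt c : (#|below c| < n)%N.
  rewrite -[X in (_ < X)%N]card_ord -cardsT; apply: proper_card.
  by rewrite properT; apply/eqP => /setP/(_ c); rewrite !inE ltxx.
pose r c := Ordinal (below_lt c).
have r_lt c d : key c < key d -> (r c < r d)%N.
  move=> h; apply: proper_card; rewrite properE; apply/andP; split.
    by apply/subsetP => e; rewrite !inE => /lt_trans; exact.
  by apply/negP => /subsetP/(_ c); rewrite !inE h ltxx => /(_ isT).
have r_inj : injective r.
  move=> c d e; apply: key_inj; case: (ltgtP (key c) (key d)) => // /r_lt.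
    by rewrite e ltnn.
  by rewrite e ltnn.
have key_rv c d : (key (rv c) < key (rv d)) = (key d < key c).
  by rewrite /key !rv_val; have := congr1 (fun z => n%:Z * z) (fV c d);
    rewrite !mulrDr; lia.
exists (perm r_inj) => [c|c d h]; rewrite !permE; last first.
  by apply: r_lt; rewrite /key; have := ltn_ord c; have := ltn_ord d; nia.
apply: val_inj => /=.
have -> : #|below (rv c)| = #|[set d | key c < key d]|.
  rewrite -(card_preimset (below (rv c)) (inv_inj (@rvK m))).
  by apply: eq_card => d; rewrite !inE key_rv.
have := cardsC (below c); rewrite card_ord.
have -> : ~: below c = c |: [set d | key c < key d].
  apply/setP => d; rewrite !inE -leNgt le_eqVlt.
  by rewrite (inj_eq key_inj) eq_sym.
by rewrite cardsU1 inE ltxx /=; lia.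
Qed.

Lemma vtx_transl (l : {ffun 'I_n -> int}) (i : int) c :
  vtx (transl l) i c = l c + vtx (aid n) i c.
Proof. by rewrite -[transl l]amul_id (vtxM n_gt1) /= invg1 perm1. Qed.

Lemma sumtr_transl (s : {perm 'I_n}) mu : sumtr (transl (pact s mu)) = \sum_c mu c.
Proof.
rewrite /sumtr [RHS](reindex_inj (@perm_inj _ s^-1%g)).
by apply: eq_bigr => c _; rewrite /= ffunE.
Qed.

Lemma GSp_transl (s : {perm 'I_n}) mu : in_Xstar mu -> in_Sstar s ->
  GSpgrp (transl (pact s mu)).
Proof.
move=> hmu /in_Sstar_inv hs; split=> [a b|j] /=; last by rewrite !perm1.
by rewrite !ffunE !hs.
Qed.

(* The displacement [win x c - c] decides the sign of each term of every
   [cnt i j x], so [cnt i j x] is the sum over the coordinates of large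
   displacement; dominance of [x (omega i) - omega i] by [mu], read off from
   [cnt i (i - n k)], bounds that sum when [nu] is sorted like the
   displacement. *)
Lemma cnt_le_sorted (J : int -> Prop) x (nu nu' : {ffun 'I_n -> int}) :
  (forall F : int -> int, \sum_c F (nu c) = \sum_c F (nu' c)) ->
  (forall c d, win x d - (d : nat)%:Z < win x c - (c : nat)%:Z ->
    nu d <= nu c) ->
  cnt_le J x (transl nu') -> cnt_le J x (transl nu).
Proof.
move=> same sorted h i Ji j.
pose U c := i - j < win x c - (c : nat)%:Z.
(* Membership in [U] compares the numerators of the two floors, and taking floors is monotone. *)
have termU c : U c -> vtx (aid n) j c <= vtx x i c.
  rewrite /U /vtx win_id => hU.
  have := divz_bounds n_gt1 (win x c - i).
  have := divz_bounds n_gt1 ((c : nat)%:Z - j).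
  set p := (_ %/ _)%Z; set q := (_ %/ _)%Z => /andP[p1 p2] /andP[q1 q2].
  by rewrite leNgt; apply/negP => qp; nia.
have termN c : ~~ U c -> vtx x i c <= vtx (aid n) j c.
  rewrite /U /vtx win_id -leNgt => hU.
  have := divz_bounds n_gt1 (win x c - i).
  have := divz_bounds n_gt1 ((c : nat)%:Z - j).
  set p := (_ %/ _)%Z; set q := (_ %/ _)%Z => /andP[p1 p2] /andP[q1 q2].
  by rewrite leNgt; apply/negP => qp; nia.
have -> : cnt i j x = \sum_(c | U c) (vtx x i c - vtx (aid n) j c).
  rewrite [RHS]big_mkcond; apply: eq_bigr => c _; case: ifPn => [/termU|/termN].
    by lia.
  by lia.
have cntU (l : {ffun 'I_n -> int}) :
    \sum_(c | U c) (l c + vtx (aid n) i c - vtx (aid n) j c) <=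
    cnt i j (transl l).
  rewrite big_mkcond; apply: ler_sum => c _; rewrite vtx_transl; case: ifP => _.
    by lia.
  by lia.
case: (pickP U) => [c1 Uc1|U0]; last first.
  by rewrite big_pred0 //; apply: sumr_ge0 => c _; rewrite le_max lexx.
apply: le_trans (cntU nu).
(* With [k] the least value of [nu] on [U], sortedness gives [nu <= k] off [U], so the positive
   parts of [nu - k] add up over [U] alone. *)
have [c0 Uc0 minc0] := arg_minP (fun c => nu c) Uc1.
pose k := nu c0.
have cnt_dom y : cnt i (i - n%:Z * k) y =
    \sum_c Num.max 0 (vtx y i c - vtx (aid n) i c - k).
  by apply: eq_bigr => c _; rewrite (vtx_shift n_gt1) opprD addrA.
have cnt_dom_transl (l : {ffun 'I_n -> int}) : cnt i (i - n%:Z * k) (transl l) =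
    \sum_c Num.max 0 (l c - k).
  by rewrite cnt_dom; apply: eq_bigr => c _; rewrite vtx_transl addrK.
have := h i Ji (i - n%:Z * k); rewrite cnt_dom cnt_dom_transl.
rewrite -(same (fun z => Num.max 0 (z - k))).
have -> : \sum_c Num.max 0 (nu c - k) = \sum_(c | U c) (nu c - k).
  rewrite [RHS]big_mkcond; apply: eq_bigr => c _; case: ifPn => hc.
    by have := minc0 c hc; rewrite -/k; lia.
  have : nu c <= k by apply: sorted; move: hc Uc0; rewrite /U; lia.
  by lia.
have : \sum_(c | U c) (vtx x i c - vtx (aid n) i c - k) <=
    \sum_c Num.max 0 (vtx x i c - vtx (aid n) i c - k).
  by rewrite big_mkcond; apply: ler_sum => c _; case: ifP => _; lia.
move=> h1 h2; have := le_trans h1 h2; rewrite -subr_ge0 -sumrB => h3.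
rewrite -subr_ge0 -sumrB.
(* Both sums run over the same [U], so the constant [k] cancels termwise. *)
rewrite (eq_bigr (fun c => nu c - k - (vtx x i c - vtx (aid n) i c - k))) //.
by move=> c _; ring.
Qed.

Lemma pact_sum (s : {perm 'I_n}) mu (F : int -> int) :
  \sum_c F (pact s mu c) = \sum_c F (mu c).
Proof.
rewrite [RHS](reindex_inj (@perm_inj _ s^-1%g)).
by apply: eq_bigr => c _; rewrite /= ffunE.
Qed.

Lemma sorting_translation x mu : GSpgrp x -> in_Xstar mu ->
  exists2 s : {perm 'I_n}, in_Sstar s &
    forall c d, win x d - (d : nat)%:Z < win x c - (c : nat)%:Z ->
      pact s mu d <= pact s mu c.
Proof.
move=> gx hmu.
have [r sr hr] : exists2 r : {perm 'I_n}, in_Sstar r & forall c d,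
    win x c - (c : nat)%:Z < win x d - (d : nat)%:Z -> (r c < r d)%N.
  by apply: sorting_perm => a b; rewrite !rv_val; have := GSp_win m_gt0 a b gx; lia.
have [p sp hp] := sorting_perm hmu.
(* Here [p] ranks the entries of [mu] and [r] the displacements; the composite sends each entry of
   [mu] to the coordinate of equal rank. *)
exists (p * r^-1)%g => [j|c d /hr lt].
  by rewrite !permM sp (in_Sstar_inv sr).
rewrite !ffunE invMg invgK !permM leNgt; apply/negP => /hp; rewrite !permKV.
by rewrite ltnNge ltnW.
Qed.

End Comparison.

(* Adm_{GSp,I}(mu) = Adm_{GL,+-I}(mu) /\ W~/W_I inside W~_GL / W_{GL,+-I}:
   a coset C = w W_{GL,+-I} lies in the image of Adm_{GSp,I}(mu) iff it lies in
   Adm_{GL,+-I}(mu) and meets W~. *)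
Theorem theorem6p3p1 (m : nat) (hm : (1 <= m)%N) (I : {set 'I_m.+1})
  (hI : I != set0) (mu : {ffun 'I_(m.*2) -> int}) (hmu : in_Xstar mu)
  (w : aff (m.*2)) :
  (exists w', [/\ GSpgrp w', in_coset (W_GL_pmI I) w w' & Adm_GSp I mu w'])
  <->
  (Adm_GL I mu w /\ exists w', GSpgrp w' /\ in_coset (W_GL_pmI I) w w').
Proof.
have n_gt1 := double_gt1 hm.
have coset w' : in_coset (W_GL_pmI I) w w' ->
    sumtr w = sumtr w' /\
    forall i, in_pmI I i -> forall j, cnt i j w = cnt i j w'.
  apply: (@in_coset_cnt _ n_gt1 (@GLgrp m)) => //; last exact: in_pmI_ex.
  by move=> v; rewrite (W_GL_pmI_vtx hm); split=> [|[]].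
split=> [[w' [gw' cw [s [ss le]]]]|[[s le] [w' [gw' cw]]]].
  have [e1 e2] := coset w' cw.
  split; last by exists w'.
  exists s; apply/(GL_coset_leP hm) => //.
  (* Both orders are described by the same counts, so the same [s] serves for GL. *)
  have /(GSp_coset_leP hm hI gw')[] := le; first exact: GSp_transl.
  by rewrite -e1 => h1 h2; split=> // i Ji j; rewrite e2 //; exact: h2.
have [e1 e2] := coset w' cw; exists w'; split=> //.
(* The given [s] may lie outside S*_{2m}; it is replaced by a [t] that sorts [mu] like the
   displacement of [w']. *)
have [t st sorted] := sorting_translation hm gw' hmu.
exists t; split=> //; apply/(GSp_coset_leP hm hI gw'); first exact: GSp_transl.
have /(GL_coset_leP hm _ _ hI)[h1 h2] := le.
split; first by rewrite -e1 h1 !sumtr_transl.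
apply: (cnt_le_sorted hm (nu' := pact s mu)) => // [F|i Ji j].
  by rewrite !pact_sum.
by rewrite -e2 //; exact: h2.
Qed.
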